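(* There is an algorithm which, given a monic polynomial $P\in\mathbf{K}[X]$ and polynomials $Q_1,\ldots,Q_r\in\mathbf{K}[X]$, computes the multiset of $(r+1)$-tuples of values $$\left[\left(v(x_i),v(Q_1(x_i)),\ldots,v(Q_r(x_i))\right)\right]_{i=1,\ldots,d},$$ where $[x_1,\ldots,x_d]$ is the multiset of roots (with multiplicities) of $P$ in the algebraic closure $\mathbf{K}^{\rm ac}$.
   Context: $\mathbf{K}$ is a valued field with valuation ring $\mathbf{V}$, and $\mathbf{S}\subseteq\mathbf{V}$ is a subring whose quotient field is $\mathbf{K}$. Computability assumptions: $\mathbf{S}$ is an explicit ring (its algebraic operations and equality test are explicit), and for any two elements of $\mathbf{S}$ one can test whether one divides the other in $\mathbf{V}$; no polynomial factorization algorithm is assumed. $\mathbf{K}^{\rm ac}$ is the algebraic closure of $\mathbf{K}$ with a valuation ring $\mathbf{V}^{\rm ac}$ extending $\mathbf{V}$; $v$ is the corresponding valuation on $\mathbf{K}^{\rm ac}$, with value group the divisible hull of the value group of $\mathbf{K}$, and $v(0)=\infty$. A value $v(x)$, $x\in\mathbf{K}^{\rm ac}$, is computed when one knows an integer $m\ge 1$ and elements $f\neq 0$, $g$ of $\mathbf{S}$, given as integer polynomials in the coefficients of the problem, such that $f x^m=ug$ for some unit $u$ of $\mathbf{V}^{\rm ac}$, i.e. $m\,v(x)=v(g)-v(f)$. A multiset is a list up to permutation. *)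

(* Defs.v *)
From HB Require Import structures.
From mathcomp Require Import all_boot all_order all_algebra.
From mathcomp Require Import mpoly.
From Stdlib Require List.

Set Implicit Arguments.
Unset Strict Implicit.
Unset Printing Implicit Defensive.

Import GRing.Theory.
Local Open Scope ring_scope.

(** * Algorithms over an explicit ring with a divisibility test

  An algorithm is a finite piece of syntax: a while loop whose parts are closed
  simply typed lambda-terms over booleans, naturals, pairs and lists with
  primitive recursion.  It is therefore Turing complete, and it is independent
  of the ring it is run on.

  The type [Scal] holds the elements of [S] the algorithm computes, each kept
  as an integer polynomial in the coefficients [c] of the problem.  Terms can
  combine scalars by ring operations and otherwise only observe them through
  two tests on their values at [c]: equality to zero in [S], and divisibility
  in [V]. *)

Inductive ty : Type :=
| Bool | Nat | Scal
| Prod of ty & ty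
| List of ty
| Arr of ty & ty.

Declare Scope ty_scope.
Delimit Scope ty_scope with ty.
Bind Scope ty_scope with ty.
Notation "a ==> b" := (Arr a b) : ty_scope.
Notation "a * b" := (Prod a b) : ty_scope.

Inductive const : ty -> Type :=
| CTrue : const Bool
| CFalse : const Bool
| CIf a : const (Bool ==> a ==> a ==> a)
| CZero : const Nat
| CSucc : const (Nat ==> Nat)
| CNatRec a : const (a ==> (Nat ==> a ==> a) ==> Nat ==> a)
| CPair a b : const (a ==> b ==> a * b)
| CFst a b : const (a * b ==> a)
| CSnd a b : const (a * b ==> b)
| CNil a : const (List a)
| CCons a : const (a ==> List a ==> List a)
| CListRec a b : const (b ==> (a ==> List a ==> b ==> b) ==> List a ==> b)
| CScal0 : const Scal
| CScal1 : const Scal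
| CAdd : const (Scal ==> Scal ==> Scal)
| COpp : const (Scal ==> Scal)
| CMul : const (Scal ==> Scal ==> Scal)
| CIsZero : const (Scal ==> Bool)
| CDvd : const (Scal ==> Scal ==> Bool).

(* de Bruijn indices *)
Inductive var : seq ty -> ty -> Type :=
| VZ G a : var (a :: G) a
| VS G a b : var G a -> var (b :: G) a.

Inductive term : seq ty -> ty -> Type :=
| Cst G a : const a -> term G a
| Var G a : var G a -> term G a
| Lam G a b : term (a :: G) b -> term G (a ==> b)
| App G a b : term G (a ==> b) -> term G a -> term G b.

Fixpoint interp (n : nat) (t : ty) : Type :=
  match t with
  | Bool => bool
  | Nat => nat
  | Scal => {mpoly int[n]}
  | Prod a b => (interp n a * interp n b)%type
  | List a => seq (interp n a)
  | Arr a b => interp n a -> interp n b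
  end.

Fixpoint env (n : nat) (G : seq ty) : Type :=
  if G is a :: G' then (interp n a * env n G')%type else unit.

(* the value at [c] of an integer polynomial *)
Definition zeval (S : comNzRingType) (n : nat) (c : 'I_n -> S)
    (f : {mpoly int[n]}) : S :=
  mmap (intr : int -> S) c f.

Fixpoint natrec (A : Type) (z : A) (s : nat -> A -> A) (k : nat) : A :=
  if k is k'.+1 then s k' (natrec z s k') else z.

Fixpoint listrec (A B : Type) (z : B) (s : A -> seq A -> B -> B)
    (l : seq A) : B :=
  if l is x :: l' then s x l' (listrec z s l') else z.

Definition cst_den (S : comNzRingType) (dvdV : rel S) (n : nat)
    (c : 'I_n -> S) (a : ty) (k : const a) : interp n a :=
  match k in const a return interp n a with
  | CTrue => true
  | CFalse => false
  | CIf a => fun (b : bool) (x y : interp n a) => if b then x else y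
  | CZero => 0%N
  | CSucc => succn
  | CNatRec a => @natrec (interp n a)
  | CPair a b => fun (x : interp n a) (y : interp n b) => (x, y)
  | CFst a b => fun x : interp n a * interp n b => x.1
  | CSnd a b => fun x : interp n a * interp n b => x.2
  | CNil a => [::]
  | CCons a => fun (x : interp n a) l => x :: l
  | CListRec a b => @listrec (interp n a) (interp n b)
  | CScal0 => 0 : {mpoly int[n]}
  | CScal1 => 1 : {mpoly int[n]}
  | CAdd => fun f g : {mpoly int[n]} => f + g
  | COpp => fun f : {mpoly int[n]} => - f
  | CMul => fun f g : {mpoly int[n]} => f * g
  | CIsZero => fun f : {mpoly int[n]} => zeval c f == 0
  | CDvd => fun f g : {mpoly int[n]} => dvdV (zeval c f) (zeval c g)
  end.

Fixpoint var_den (n : nat) (G : seq ty) (a : ty) (x : var G a) :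
    env n G -> interp n a :=
  match x in var G a return env n G -> interp n a with
  | VZ G a => fun e : interp n a * env n G => e.1
  | VS G a b y => fun e : interp n b * env n G => var_den y e.2
  end.

Fixpoint term_den (S : comNzRingType) (dvdV : rel S) (n : nat) (c : 'I_n -> S)
    (G : seq ty) (a : ty) (t : term G a) : env n G -> interp n a :=
  match t in term G a return env n G -> interp n a with
  | Cst G a k => fun=> cst_den dvdV c k
  | Var G a x => fun e => var_den x e
  | Lam G a b u => fun e (x : interp n a) => term_den dvdV c u (x, e)
  | App G a b u w => fun e => (term_den dvdV c u e) (term_den dvdV c w e)
  end.

Definition run (S : comNzRingType) (dvdV : rel S) (n : nat) (c : 'I_n -> S)
    (a : ty) (t : term [::] a) : interp n a :=
  term_den dvdV c t tt.

(* s := init input; while busy s do s := next s; return (result s) *)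
Record algorithm (i o : ty) : Type := Algorithm {
  state : ty;
  init : term [::] (i ==> state);
  busy : term [::] (state ==> Bool);
  next : term [::] (state ==> state);
  result : term [::] (state ==> o)
}.

(* [A] terminates on input [x] with output [y] *)
Definition computes (S : comNzRingType) (dvdV : rel S) (n : nat)
    (c : 'I_n -> S) (i o : ty) (A : algorithm i o)
    (x : interp n i) (y : interp n o) : Prop :=
  let st k := iter k (run dvdV c (next A)) (run dvdV c (init A) x) in
  exists k : nat,
    [/\ forall l : nat, (l < k)%N -> run dvdV c (busy A) (st l) = true,
        run dvdV c (busy A) (st k) = false
      & y = run dvdV c (result A) (st k)].

(** * Valued fields *)

Definition valuation_ring (K : fieldType) (V : {pred K}) : Prop :=
  subring_closed V /\ forall x : K, (x \in V) || (x^-1 \in V).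

(* [u != 0] is needed since [0^-1 = 0] *)
Definition is_unit_of (K : fieldType) (V : {pred K}) (u : K) : Prop :=
  [/\ u != 0, u \in V & u^-1 \in V].

(* [a] divides [b] in [V] *)
Definition divides_in (K : fieldType) (V : {pred K}) (a b : K) : Prop :=
  exists2 w : K, w \in V & b = w * a.

(* A computed value: [(m, (f, g))] describes [v(y)] when [m >= 1], [f <> 0] and
   [f * y ^ m = u * g] for a unit [u], that is [m v(y) = v(g) - v(f)]; the case
   [g = 0] is [v(y) = oo].  Here [j] is the embedding of [S] in the field. *)
Definition is_value (S : comNzRingType) (L : fieldType) (j : S -> L)
    (W : {pred L}) (n : nat) (c : 'I_n -> S)
    (mfg : nat * ({mpoly int[n]} * {mpoly int[n]})) (y : L) : Prop :=
  let: (m, (f, g)) := mfg in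
  [/\ (1 <= m)%N, zeval c f != 0
    & exists2 u : L, is_unit_of W u &
        j (zeval c f) * y ^+ m = u * j (zeval c g)].

(** * Inputs and outputs *)

(* A polynomial of K[X] is given by the list of its coefficients, constant term
   first, each a quotient [c_i / c_k] of two coefficients of the problem. *)
Definition presents (S : comNzRingType) (K : fieldType) (iS : S -> K) (n : nat)
    (c : 'I_n -> S) (p : seq ('I_n * 'I_n)) (P : {poly K}) : Prop :=
  all (fun ik => c ik.2 != 0) p
  /\ P = Poly [seq iS (c ik.1) / iS (c ik.2) | ik <- p].

Definition poly_ty : ty := List (Scal * Scal).
Definition input_ty : ty := poly_ty * List poly_ty.
Definition value_ty : ty := Nat * (Scal * Scal).
Definition output_ty : ty := List (List value_ty).

Definition poly_in (n : nat) (p : seq ('I_n * 'I_n)) : interp n poly_ty :=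
  [seq ('X_ik.1 : {mpoly int[n]}, 'X_ik.2 : {mpoly int[n]}) | ik <- p].

Definition input (n : nat) (p : seq ('I_n * 'I_n))
    (qs : seq (seq ('I_n * 'I_n))) : interp n input_ty :=
  (poly_in p, [seq poly_in q | q <- qs]).

(* Main.v *)
(* The roots [x] of [P] enter only through the companion matrix [C] of [P]: for
   a polynomial [q], det (1 + T q(C)) is the product of the 1 + q(x) T, and all
   its coefficients are computed in [S] after clearing denominators.  The
   Newton polygon of this product gives candidates for the values v(q(x)), and
   the number of [x] with v(q(x)) = v(g) / m - v(f) / m is the horizontal length
   of the polygon after rescaling, that is, the distance between the first and
   the last index at which the coefficients are of minimal value.
   To count the [x] satisfying several such conditions v(eta_i(x)) = 0 at once,
   the condition is tested on the products of powers of the eta_i: each test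
   overcounts, and a pigeonhole argument shows that one is exact, so that the
   answer is the minimum over bounded exponents.  Conditions v(q(x)) = oo are
   obtained by subtracting all the finite values of q(x). *)

Require Import Defs.
From mathcomp Require Import all_boot all_order all_algebra.
From mathcomp Require Import mpoly ring.
From Stdlib Require List.
From Stdlib Require Import FunctionalExtensionality.

Set Implicit Arguments.
Unset Strict Implicit.
Unset Printing Implicit Defensive.

Import GRing.Theory.
Local Open Scope ring_scope.

(** * Definable functions *)

(** Without factorization the roots cannot be told apart, and the Newton polygon of one [q] gives
    the values v(q(x)) but not how they pair up with the values of another polynomial. Joint
    conditions are therefore counted over all tuples of candidate values. A finite condition m
    v(q(x)) = v(g) - v(f) says that f q(x)^m / g is a unit, and this element is again a polynomial
    in x, up to scalars kept aside as the pair (f, g). Exponents up to [d] suffice at each product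
    because d + 1 failing exponents would have to share one of the d roots. One closed term has to
    serve every ring. The algorithm is thus written as ordinary functions indexed by a context
    (ring, test, coefficients), and each of them is shown to be denoted by a term. Correctness is
    proved through a single morphism [phi] from the integer polynomials to the closed field, in
    terms of which both tests are expressed. *)

Record ctx := Ctx {
  cS : comNzRingType;
  cdvd : rel cS;
  cn : nat;
  cc : 'I_cn -> cS
}.

Local Notation den k := (term_den (@cdvd k) (@cc k)).

(** The term is chosen before the context [k], so the same syntax works over all rings. Having one
    term for each typing context [G] allows insertion under binders without a weakening
    operation. *)
Class definable (a : ty) (f : forall k : ctx, interp (cn k) a) : Type :=
  Definable : forall G, {t : term G a | forall k e, den k t e = f k}.

Section Reify.
Variables (k : ctx) (G : seq ty) (e : env (cn k) G).

Lemma den_var a (x : var G a) : den k (Var x) e = var_den x e.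
Proof. by []. Qed.

Lemma den_app a b (t : term G (a ==> b)) (u : term G a) f x :
  den k t e = f -> den k u e = x -> den k (App t u) e = f x.
Proof. by move=> <- <-. Qed.

Lemma den_lam a b (t : term (a :: G) b) (f : interp (cn k) (a ==> b)) :
  (forall x, @term_den _ (@cdvd k) _ (@cc k) (a :: G) b t (x, e) = f x) ->
  den k (Lam t) e = f.
Proof. by move=> tf; apply: functional_extensionality. Qed.

Lemma den_if a (t : term G Bool) (u v : term G a) b x y :
  den k t e = b -> den k u e = x -> den k v e = y ->
  den k (App (App (App (Cst G (CIf a)) t) u) v) e = if b then x else y.
Proof. by move=> <- <- <-. Qed.

Lemma den_def a (f : forall k, interp (cn k) a) (d : definable f) :
  den k (sval (d G)) e = f k.
Proof. exact: (proj2_sig (d G) k e). Qed.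

End Reify.

Lemma def_cst a (x : const a) : definable (fun k => cst_den (@cdvd k) (@cc k) x).
Proof. by move=> G; exists (Cst G x). Qed.

(* Unification leaves [interp] unfolded to a fixpoint applied to a [ty]; any
   other application is the type of scalars. *)
Ltac ty_of T :=
  lazymatch T with
  | nat => constr:(Nat)
  | bool => constr:(Bool)
  | interp _ ?a => a
  | seq ?A => let a := ty_of A in constr:(List a)
  | list ?A => let a := ty_of A in constr:(List a)
  | prod ?A ?B => let a := ty_of A in let b := ty_of B in constr:(Prod a b)
  | ?A -> ?B => let a := ty_of A in let b := ty_of B in constr:(Arr a b)
  | _ ?a => lazymatch type of a with ty => a | _ => constr:(Scal) end
  end.

Ltac find_var x e :=
  lazymatch e with
  | (x, _) => uconstr:(VZ _ _)
  | (_, ?e') => let v := find_var x e' in uconstr:(VS _ v)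
  end.

Ltac reify_var :=
  lazymatch goal with
  | |- @term_den _ (@cdvd ?k) _ _ ?G ?a _ ?e = ?x =>
      let v := find_var x e in exact (@den_var k G e a v)
  end.

(** Abstracting [k] turns the expression into a family over all contexts, the form in which instance
    search can find its definability. *)
Ltac reify_def :=
  lazymatch goal with
  | |- @term_den _ (@cdvd ?k) _ _ ?G ?a _ ?e = ?x =>
      lazymatch eval pattern k in x with
      | ?f _ => exact (@den_def k G e a f _)
      end
  end.

(** The term is an existential variable, filled in by unification while the right-hand side is
    traversed. *)
Ltac reify :=
  cbv beta zeta;
  first
  [ reify_var
  | reify_def
  | lazymatch goal with
    | |- @term_den _ (@cdvd ?k) _ _ ?G (?a ==> ?b) _ ?e = (fun x => _) =>
        refine (@den_lam k G e a b _ _ _); let x := fresh "x" in intro x; reify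
    | |- @term_den _ (@cdvd ?k) _ _ ?G ?b _ ?e = (if _ then _ else _) =>
        refine (@den_if k G e b _ _ _ _ _ _ _ _ _); reify
    | |- @term_den _ (@cdvd ?k) _ _ ?G ?b _ ?e = ?f ?x =>
        let X := type of x in let a := ty_of X in
        refine (@den_app k G e a b _ _ f x _ _); reify
    end ].

Ltac define := let G := fresh "G" in
  intro G; refine (exist _ _ _); let k := fresh "k" in let e := fresh "e" in
  intros k e.

(** [F] is an extensionally equal form of the function, built from what is already definable; the
    equality is the goal left over. *)
Ltac define_as F :=
  let G := fresh "G" in intro G; refine (exist _ _ _);
  let k := fresh "k" in let e := fresh "e" in intros k e;
  transitivity (F k); [ cbv beta; reify | ].

(** * Definability of the constants and of library functions *)

#[local] Instance def_true : @definable Bool (fun k => true).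
Proof. exact: (def_cst CTrue). Qed.
#[local] Instance def_false : @definable Bool (fun k => false).
Proof. exact: (def_cst CFalse). Qed.
#[local] Instance def_zero : @definable Nat (fun k => 0%N).
Proof. exact: (def_cst CZero). Qed.
#[local] Instance def_succ : @definable (Nat ==> Nat) (fun k => S).
Proof. exact: (def_cst CSucc). Qed.
Lemma def_natrec a : @definable (a ==> (Nat ==> a ==> a) ==> Nat ==> a)
  (fun k => @natrec (interp (cn k) a)).
Proof. exact: (def_cst (CNatRec a)). Qed.
#[local] Hint Extern 1 (definable _) => refine (def_natrec _) : typeclass_instances.
Lemma def_pair a b : @definable (a ==> b ==> a * b)
  (fun k => @pair (interp (cn k) a) (interp (cn k) b)).
Proof. exact: (def_cst (CPair a b)). Qed.
#[local] Hint Extern 1 (definable _) => refine (def_pair _ _) : typeclass_instances.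
Lemma def_fst a b : @definable (a * b ==> a)
  (fun k => @fst (interp (cn k) a) (interp (cn k) b)).
Proof. exact: (def_cst (CFst a b)). Qed.
#[local] Hint Extern 1 (definable _) => refine (def_fst _ _) : typeclass_instances.
Lemma def_snd a b : @definable (a * b ==> b)
  (fun k => @snd (interp (cn k) a) (interp (cn k) b)).
Proof. exact: (def_cst (CSnd a b)). Qed.
#[local] Hint Extern 1 (definable _) => refine (def_snd _ _) : typeclass_instances.
Lemma def_nil a : @definable (List a) (fun k => @nil (interp (cn k) a)).
Proof. exact: (def_cst (CNil a)). Qed.
#[local] Hint Extern 1 (definable _) => refine (def_nil _) : typeclass_instances.
Lemma def_cons a : @definable (a ==> List a ==> List a)
  (fun k => @cons (interp (cn k) a)).
Proof. exact: (def_cst (CCons a)). Qed.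
#[local] Hint Extern 1 (definable _) => refine (def_cons _) : typeclass_instances.
Lemma def_listrec a b :
  @definable (b ==> (a ==> List a ==> b ==> b) ==> List a ==> b)
  (fun k => @listrec (interp (cn k) a) (interp (cn k) b)).
Proof. exact: (def_cst (CListRec a b)). Qed.
#[local] Hint Extern 1 (definable _) => refine (def_listrec _ _) : typeclass_instances.
#[local] Instance def_zeroS : @definable Scal (fun k => 0 : {mpoly int[cn k]}).
Proof. exact: (def_cst CScal0). Qed.
#[local] Instance def_oneS : @definable Scal (fun k => 1 : {mpoly int[cn k]}).
Proof. exact: (def_cst CScal1). Qed.
#[local] Instance def_addS : @definable (Scal ==> Scal ==> Scal)
  (fun k => @GRing.add {mpoly int[cn k]}).
Proof. exact: (def_cst CAdd). Qed.
#[local] Instance def_oppS : @definable (Scal ==> Scal)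
  (fun k => @GRing.opp {mpoly int[cn k]}).
Proof. exact: (def_cst COpp). Qed.
#[local] Instance def_mulS : @definable (Scal ==> Scal ==> Scal)
  (fun k => @GRing.mul {mpoly int[cn k]}).
Proof. exact: (def_cst CMul). Qed.


Lemma def_foldr a b : @definable ((a ==> b ==> b) ==> b ==> List a ==> b)
  (fun k => @foldr (interp (cn k) a) (interp (cn k) b)).
Proof.
define_as (fun k (f : interp (cn k) (a ==> b ==> b)) (z : interp (cn k) b) s =>
  listrec z (fun (x : interp (cn k) a) _ r => f x r) s).
by extensionality f; extensionality z; extensionality s; elim: s => //= y s ->.
Qed.
#[local] Hint Extern 1 (definable _) => refine (def_foldr _ _) : typeclass_instances.

Lemma def_map a b : @definable ((a ==> b) ==> List a ==> List b)
  (fun k => @map (interp (cn k) a) (interp (cn k) b)).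
Proof.
define_as (fun k (f : interp (cn k) (a ==> b)) s =>
  foldr (fun (x : interp (cn k) a) r => f x :: r) [::] s).
by extensionality p; extensionality s; elim: s => //= y s ->.
Qed.
#[local] Hint Extern 1 (definable _) => refine (def_map _ _) : typeclass_instances.

Lemma def_filter a : @definable ((a ==> Bool) ==> List a ==> List a)
  (fun k => @filter (interp (cn k) a)).
Proof.
define_as (fun k (p : interp (cn k) (a ==> Bool)) s =>
  foldr (fun (x : interp (cn k) a) r => if p x then x :: r else r) [::] s).
by extensionality p; extensionality s; elim: s => //= y s ->.
Qed.
#[local] Hint Extern 1 (definable _) => refine (def_filter _) : typeclass_instances.

Lemma def_cat a : @definable (List a ==> List a ==> List a)
  (fun k => @cat (interp (cn k) a)).
Proof.
define_as (fun k (s1 s2 : seq (interp (cn k) a)) =>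
  foldr (fun (x : interp (cn k) a) r => x :: r) s2 s1).
by extensionality p; extensionality s; elim: p => //= y p ->.
Qed.
#[local] Hint Extern 1 (definable _) => refine (def_cat _) : typeclass_instances.

Lemma def_flatten a : @definable (List (List a) ==> List a)
  (fun k => @flatten (interp (cn k) a)).
Proof. by define; rewrite /flatten; reify. Qed.
#[local] Hint Extern 1 (definable _) => refine (def_flatten _) : typeclass_instances.

#[local] Instance def_andb : @definable (Bool ==> Bool ==> Bool) (fun k => andb).
Proof. by define; rewrite /andb; reify. Qed.

#[local] Instance def_orb : @definable (Bool ==> Bool ==> Bool) (fun k => orb).
Proof. by define; rewrite /orb; reify. Qed.

#[local] Instance def_negb : @definable (Bool ==> Bool) (fun k => negb).
Proof. by define; rewrite /negb; reify. Qed.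

Lemma def_all a : @definable ((a ==> Bool) ==> List a ==> Bool)
  (fun k => @all (interp (cn k) a)).
Proof.
define_as (fun k (p : interp (cn k) (a ==> Bool)) s =>
  foldr (fun (x : interp (cn k) a) r => p x && r) true s).
by extensionality p; extensionality s; elim: s => //= y s ->.
Qed.
#[local] Hint Extern 1 (definable _) => refine (def_all _) : typeclass_instances.

Lemma def_has a : @definable ((a ==> Bool) ==> List a ==> Bool)
  (fun k => @has (interp (cn k) a)).
Proof.
define_as (fun k (p : interp (cn k) (a ==> Bool)) s =>
  foldr (fun (x : interp (cn k) a) r => p x || r) false s).
by extensionality p; extensionality s; elim: s => //= y s ->.
Qed.
#[local] Hint Extern 1 (definable _) => refine (def_has _) : typeclass_instances.

#[local] Instance def_predn : @definable (Nat ==> Nat) (fun k => predn).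
Proof.
define_as (fun k : ctx => natrec 0%N (fun m _ => m)).
by extensionality m; case: m.
Qed.

Lemma def_iter a : @definable (Nat ==> (a ==> a) ==> a ==> a)
  (fun k => @iter (interp (cn k) a)).
Proof.
define_as (fun k m (f : interp (cn k) (a ==> a)) (z : interp (cn k) a) =>
  natrec z (fun _ r => f r) m).
by extensionality m; extensionality f; extensionality z; elim: m => //= m ->.
Qed.
#[local] Hint Extern 1 (definable _) => refine (def_iter _) : typeclass_instances.

#[local] Instance def_addn : @definable (Nat ==> Nat ==> Nat) (fun k => addn).
Proof.
define_as (fun (k : ctx) m p => iter m S p).
by extensionality m; extensionality p; rewrite iter_succn addnC.
Qed.

#[local] Instance def_subn : @definable (Nat ==> Nat ==> Nat) (fun k => subn).
Proof.
define_as (fun (k : ctx) m p => iter p predn m).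
by extensionality m; extensionality p; elim: p => [|p /= ->]; rewrite ?subn0 ?subnS.
Qed.

#[local] Instance def_leq : @definable (Nat ==> Nat ==> Bool) (fun k => leq).
Proof.
define_as (fun (k : ctx) m p => natrec true (fun _ _ => false) (m - p)).
by extensionality m; extensionality p; rewrite /leq; case: (m - p)%N.
Qed.

#[local] Instance def_eqn : @definable (Nat ==> Nat ==> Bool)
  (fun k => @eq_op nat).
Proof.
define_as (fun (k : ctx) (i j : nat) => (i <= j)%N && (j <= i)%N).
by extensionality i; extensionality j; rewrite eqn_leq.
Qed.

#[local] Instance def_minn : @definable (Nat ==> Nat ==> Nat) (fun k => minn).
Proof. by define; rewrite /minn; reify. Qed.

#[local] Instance def_maxn : @definable (Nat ==> Nat ==> Nat) (fun k => maxn).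
Proof. by define; rewrite /maxn; reify. Qed.

(** The start changes along the recursion, so the recursor is used at a function type; [nth] below
    is treated in the same way. *)
#[local] Instance def_iota : @definable (Nat ==> Nat ==> List Nat) (fun k => iota).
Proof.
define_as (fun (k : ctx) m n =>
  natrec (fun _ => [::]) (fun _ r m => m :: r m.+1) n m).
by extensionality m; extensionality n; elim: n m => //= n IHn m; rewrite IHn.
Qed.

Lemma def_nseq a : @definable (Nat ==> a ==> List a)
  (fun k => @nseq (interp (cn k) a)).
Proof.
define_as (fun k n (x : interp (cn k) a) => iter n (cons x) [::]).
by extensionality n; extensionality x.
Qed.
#[local] Hint Extern 1 (definable _) => refine (def_nseq _) : typeclass_instances.

Lemma def_nth a : @definable (a ==> List a ==> Nat ==> a)
  (fun k => @nth (interp (cn k) a)).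
Proof.
define_as (fun k (x0 : interp (cn k) a) s =>
  listrec (fun _ : nat => x0) (fun x _ r (n : nat) => if n == 0%N then x else r n.-1) s).
extensionality x0; extensionality s; extensionality n.
by elim: s n => [|x s IHs] [|n] //=; rewrite IHs.
Qed.
#[local] Hint Extern 1 (definable _) => refine (def_nth _) : typeclass_instances.

#[local] Instance def_exprS : @definable (Scal ==> Nat ==> Scal)
  (fun k => @GRing.exp {mpoly int[cn k]}).
Proof.
define_as (fun k (x : {mpoly int[cn k]}) n => iter n (fun r => x * r) 1).
by extensionality x; extensionality n; elim: n => // n /= ->; rewrite exprS.
Qed.

(** * The algorithm *)

Section Algorithm.
Variable k : ctx.

Local Notation R := {mpoly int[cn k]}.
(** The object language has simple types only, so a matrix is a function on all pairs of naturals
    and its size [d] is passed separately. *)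
Local Notation matrixf := (nat -> nat -> R).
Local Notation polyf := (nat -> R).
Local Notation value := (nat * (R * R))%type.

Definition is_zero (f : R) : bool := zeval (@cc k) f == 0.
Definition divides (f g : R) : bool :=
  cdvd (zeval (@cc k) f) (zeval (@cc k) g).

Definition sumf (n : nat) (f : nat -> R) : R :=
  foldr (fun i s => f i + s) 0 (iota 0 n).

Definition mulp (f g : polyf) : polyf :=
  fun m => sumf m.+1 (fun i => f i * g (m - i)%N).

Definition onem : matrixf := fun i j => if i == j then 1 else 0.

Definition mulm (d : nat) (A B : matrixf) : matrixf :=
  fun i j => sumf d (fun l => A i l * B l j).

Definition expm (d : nat) (A : matrixf) (m : nat) : matrixf :=
  iter m (mulm d A) onem.

(** Laplace expansion along the first column, which needs no division. The inner conditional skips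
    row [i]; the minor varies, so the recursion runs at a function type. *)
Definition detp (d : nat) (A : nat -> nat -> polyf) : polyf :=
  natrec (fun (_ : nat -> nat -> polyf) (m : nat) => if m == 0%N then 1 else 0 : R)
    (fun n rec (B : nat -> nat -> polyf) (m : nat) => sumf n.+1 (fun i => (-1) ^+ i *
       mulp (B i 0%N)
         (rec (fun a b => B (if (i <= a)%N then a.+1 else a) b.+1)) m))
    d A.

(* the coefficients of det (1 + T M) *)
Definition charf (d : nat) (M : matrixf) : polyf :=
  detp d (fun i j m =>
    if m == 0%N then onem i j else if m == 1%N then M i j else 0).

Definition spread (d : nat) (h : polyf) : nat :=
  let minimal j := all (fun l => divides (h j) (h l)) (iota 0 d.+1) in
  (foldr maxn 0 (filter minimal (iota 0 d.+1))
   - foldr minn d (filter minimal (iota 0 d.+1)))%N.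

(** An entry [(M, (f, g))] stands for the matrix (f / g) M. The factor g^d that clears the
    denominators is common to all coefficients and leaves the minimal ones unchanged. *)
Definition count_units (d : nat) (a : matrixf * (R * R)) : nat :=
  spread d (fun j => charf d a.1 j * a.2.1 ^+ j * a.2.2 ^+ (d - j)).

Definition mul_exp (d : nat) (a b : matrixf * (R * R)) (m : nat) :
    matrixf * (R * R) :=
  (mulm d a.1 (expm d b.1 m), (a.2.1 * b.2.1 ^+ m, a.2.2 * b.2.2 ^+ m)).

(** The products are nested: the head times a power of a whole combination of the tail. Each level
    then has to separate only two functions, with d + 1 exponents to choose from. *)
Definition combinations (d : nat) (s : seq (matrixf * (R * R))) :
    seq (matrixf * (R * R)) :=
  foldr (fun a r => flatten (map (fun b => map (mul_exp d a b) (iota 0 d.+1)) r))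
    [:: (onem, (1, 1))] s.

Definition count_all_units (d : nat) (s : seq (matrixf * (R * R))) : nat :=
  foldr minn d (map (count_units d) (combinations d s)).

(** All segments between nonzero coefficients are taken, on the polygon or not: a candidate that no
    root attains will get multiplicity zero. Coefficients beyond index [d] vanish and are filtered
    out. *)
Definition slopes (d : nat) (M : matrixf) : seq value :=
  filter (fun v => ~~ is_zero v.2.1 && ~~ is_zero v.2.2)
    (flatten (map (fun j => map (fun s =>
      (s.+1, (charf d M j, charf d M (j + s.+1)%N))) (iota 0 d.+1))
    (iota 0 d.+1))).

Definition same_value (v w : value) : bool :=
  divides (v.2.2 ^+ w.1 * w.2.1 ^+ v.1) (v.2.1 ^+ w.1 * w.2.2 ^+ v.1)
  && divides (v.2.1 ^+ w.1 * w.2.2 ^+ v.1) (v.2.2 ^+ w.1 * w.2.1 ^+ v.1).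

Definition distinct_values (s : seq value) : seq value :=
  foldr (fun v r => if has (same_value v) r then r else v :: r) [::] s.

Definition normalized (d : nat) (M : matrixf) (v : value) :
    matrixf * (R * R) :=
  (expm d M v.1, v.2).

(** In [(kappa, (M, vs))], the matrix [M] is kappa Q at the companion matrix, kappa being a cleared
    denominator, and [vs] lists the candidates for the finite values of kappa Q(x). *)
Local Notation coordinate := (R * (matrixf * seq value))%type.

(* A value whose numerator is zero stands for oo. *)
Definition multiplicity (d : nat) (t : seq (coordinate * value)) :
    seq (matrixf * (R * R)) -> nat :=
  foldr (fun xv rec acc =>
    if is_zero xv.2.2.2 then
      (rec acc - foldr addn 0 (map (fun v =>
         rec (normalized d xv.1.2.1 v :: acc)) xv.1.2.2))%N
    else rec (normalized d xv.1.2.1 xv.2 :: acc))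
  (count_all_units d) t.

(** The extra candidate [(1, (1, 0))] is oo. *)
Definition tuples (s : seq coordinate) : seq (seq (coordinate * value)) :=
  foldr (fun x r => flatten (map (fun v => map (cons (x, v)) r)
    ((1%N, (1, 0)) :: x.2.2))) [:: [::]] s.

(** From f (kappa y)^m = u g to (f kappa^m) y^m = u g. *)
Definition rescale (xv : coordinate * value) : value :=
  (xv.2.1, (xv.2.2.1 * xv.1.1 ^+ xv.2.1, xv.2.2.2)).

Definition tabulate (d : nat) (s : seq coordinate) : seq (seq value) :=
  flatten (map (fun t => nseq (multiplicity d t [::]) (map rescale t))
    (tuples s)).

(* the common denominator and the numerators over it *)
Definition clear (q : seq (R * R)) : R * seq R :=
  foldr (fun ab r => (ab.2 * r.1, ab.1 * r.1 :: map (fun x => ab.2 * x) r.2))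
    (1, [::]) q.

(** The input list may end in coefficients that vanish in the ring, so its length does not give the
    degree. *)
Definition sizep (s : seq R) : nat :=
  foldr (fun x (n : nat) => if (n == 0%N) && is_zero x then 0%N else n.+1) 0%N s.

(* D times the companion matrix of the polynomial with coefficients s / D *)
Definition companionf (d : nat) (D : R) (s : seq R) : matrixf :=
  fun i j => if i.+1 == d then - nth 0 s j else
             if i.+1 == j then D else 0.

(** Homogeneous Horner rule: [C] is D times the companion matrix, so after l coefficients the pair
    holds D^l and D^l times the value at the companion matrix. A new coefficient must be multiplied
    by D^(l+1) to match. *)
Definition hornerf (d : nat) (D : R) (C : matrixf) (s : seq R) : R * matrixf :=
  foldr (fun q r => (D * r.1,
      fun i j => q * (D * r.1) * onem i j + mulm d C r.2 i j))
    (1, fun _ _ => 0) s.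

Definition make_coordinate (d : nat) (D : R) (C : matrixf) (q : R * seq R) :
    coordinate :=
  ((hornerf d D C q.2).1 * q.1,
   ((hornerf d D C q.2).2,
    distinct_values (slopes d (hornerf d D C q.2).2))).

Definition solve_cleared (d : nat) (D : R) (C : matrixf)
    (qs : seq (seq (R * R))) : seq (seq value) :=
  tabulate d (map (fun q => make_coordinate d D C (clear q))
    (* The prepended polynomial is X, whose coordinate yields v(x). *)
    ([:: (0, 1); (1, 1)] :: qs)).

Definition solve (i : seq (R * R) * seq (seq (R * R))) : seq (seq value) :=
  solve_cleared (sizep (clear i.1).2).-1 (clear i.1).1
    (companionf (sizep (clear i.1).2).-1 (clear i.1).1 (clear i.1).2) i.2.

End Algorithm.

(** * Definability of the algorithm *)

Local Notation Matrixf := (Nat ==> Nat ==> Scal)%ty.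
Local Notation Polyf := (Nat ==> Scal)%ty.
Local Notation Coordinate := (Scal * (Matrixf * List value_ty))%ty.

Ltac define_unfold f := define; unfold f; reify.

#[local] Instance def_is_zero : @definable (Scal ==> Bool) is_zero.
Proof. exact: (def_cst CIsZero). Qed.
#[local] Instance def_divides : @definable (Scal ==> Scal ==> Bool) divides.
Proof. exact: (def_cst CDvd). Qed.
#[local] Instance def_sumf : @definable (Nat ==> (Nat ==> Scal) ==> Scal) sumf.
Proof. define_unfold sumf. Qed.
#[local] Instance def_mulp : @definable (Polyf ==> Polyf ==> Polyf) mulp.
Proof. define_unfold mulp. Qed.
#[local] Instance def_onem : @definable Matrixf onem.
Proof. define_unfold onem. Qed.
#[local] Instance def_mulm : @definable (Nat ==> Matrixf ==> Matrixf ==> Matrixf) mulm.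
Proof. define_unfold mulm. Qed.
#[local] Instance def_expm : @definable (Nat ==> Matrixf ==> Nat ==> Matrixf) expm.
Proof. define_unfold expm. Qed.
#[local] Instance def_detp : @definable (Nat ==> (Nat ==> Nat ==> Polyf) ==> Polyf) detp.
Proof. define_unfold detp. Qed.
#[local] Instance def_charf : @definable (Nat ==> Matrixf ==> Polyf) charf.
Proof. define_unfold charf. Qed.
#[local] Instance def_spread : @definable (Nat ==> Polyf ==> Nat) spread.
Proof. define_unfold spread. Qed.
#[local] Instance def_count_units :
  @definable (Nat ==> Matrixf * (Scal * Scal) ==> Nat) count_units.
Proof. define_unfold count_units. Qed.
#[local] Instance def_mul_exp :
  @definable (Nat ==> Matrixf * (Scal * Scal) ==> Matrixf * (Scal * Scal) ==>
              Nat ==> Matrixf * (Scal * Scal)) mul_exp.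
Proof. define_unfold mul_exp. Qed.
#[local] Instance def_combinations :
  @definable (Nat ==> List (Matrixf * (Scal * Scal)) ==>
              List (Matrixf * (Scal * Scal))) combinations.
Proof. define_unfold combinations. Qed.
#[local] Instance def_count_all_units :
  @definable (Nat ==> List (Matrixf * (Scal * Scal)) ==> Nat) count_all_units.
Proof. define_unfold count_all_units. Qed.
#[local] Instance def_slopes :
  @definable (Nat ==> Matrixf ==> List value_ty) slopes.
Proof. define_unfold slopes. Qed.
#[local] Instance def_same_value :
  @definable (value_ty ==> value_ty ==> Bool) same_value.
Proof. define_unfold same_value. Qed.
#[local] Instance def_distinct_values :
  @definable (List value_ty ==> List value_ty) distinct_values.
Proof. define_unfold distinct_values. Qed.
#[local] Instance def_normalized :
  @definable (Nat ==> Matrixf ==> value_ty ==> Matrixf * (Scal * Scal)) normalized.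
Proof. define_unfold normalized. Qed.
#[local] Instance def_multiplicity :
  @definable (Nat ==> List (Coordinate * value_ty) ==>
              List (Matrixf * (Scal * Scal)) ==> Nat) multiplicity.
Proof. define_unfold multiplicity. Qed.
#[local] Instance def_tuples :
  @definable (List Coordinate ==> List (List (Coordinate * value_ty))) tuples.
Proof. define_unfold tuples. Qed.
#[local] Instance def_rescale :
  @definable (Coordinate * value_ty ==> value_ty) rescale.
Proof. define_unfold rescale. Qed.
#[local] Instance def_tabulate :
  @definable (Nat ==> List Coordinate ==> output_ty) tabulate.
Proof. define_unfold tabulate. Qed.
#[local] Instance def_clear :
  @definable (poly_ty ==> Scal * List Scal) clear.
Proof. define_unfold clear. Qed.
#[local] Instance def_sizep : @definable (List Scal ==> Nat) sizep.
Proof. define_unfold sizep. Qed.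
#[local] Instance def_companionf :
  @definable (Nat ==> Scal ==> List Scal ==> Matrixf) companionf.
Proof. define_unfold companionf. Qed.
#[local] Instance def_hornerf :
  @definable (Nat ==> Scal ==> Matrixf ==> List Scal ==> Scal * Matrixf) hornerf.
Proof. define_unfold hornerf. Qed.
#[local] Instance def_make_coordinate :
  @definable (Nat ==> Scal ==> Matrixf ==> Scal * List Scal ==> Coordinate)
    make_coordinate.
Proof. define_unfold make_coordinate. Qed.
#[local] Instance def_solve_cleared :
  @definable (Nat ==> Scal ==> Matrixf ==> List poly_ty ==> output_ty)
    solve_cleared.
Proof. define_unfold solve_cleared. Qed.
#[local] Instance def_solve : @definable (input_ty ==> output_ty) solve.
Proof. define_unfold solve. Qed.

(** The loop test is constantly false: primitive recursion at higher types suffices, and the whole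
    computation sits in [result]. *)
Lemma definable_computable i o (f : forall k, interp (cn k) (i ==> o)) :
  @definable (i ==> o) f ->
  exists A : algorithm i o, forall k x, computes (@cdvd k) (@cc k) A x (f k x).
Proof.
move=> def_f; case: (def_f [::]) => t ft.
exists (@Algorithm i o i (Lam (Var (VZ [::] i))) (Lam (Cst _ CFalse))
  (Lam (Var (VZ [::] i))) t) => k x.
by exists 0%N; split => //; rewrite /run /= ft.
Qed.

(** * Valuation rings and Newton polygons *)

Section Valuation.
Variables (L : fieldType) (W : {pred L}).
Hypothesis W_valuation : valuation_ring W.

Definition vunit (u : L) : bool := [&& u != 0, u \in W & u^-1 \in W].
(** The maximal ideal: for nonzero u, having u^-1 outside W forces u into W. *)
Definition vmax (u : L) : bool := (u == 0) || (u^-1 \notin W).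

Lemma vunitP u : reflect (is_unit_of W u) (vunit u).
Proof. exact: and3P. Qed.

Lemma val1 : 1 \in W.
Proof. by case: W_valuation => -[]. Qed.

Lemma valB : {in W &, forall x y, x - y \in W}.
Proof. by case: W_valuation => -[]. Qed.

Lemma valM : {in W &, forall x y, x * y \in W}.
Proof. by case: W_valuation => -[]. Qed.

Lemma val0 : 0 \in W.
Proof. by rewrite -(subrr 1) valB ?val1. Qed.

Lemma valN x : x \in W -> - x \in W.
Proof. by move=> Wx; rewrite -sub0r valB ?val0. Qed.

Lemma valD : {in W &, forall x y, x + y \in W}.
Proof. by move=> x y Wx Wy; rewrite -[y]opprK valB ?valN. Qed.

Lemma valX x n : x \in W -> x ^+ n \in W.
Proof.
by move=> Wx; elim: n => [|n IHn]; rewrite ?val1 // exprS valM.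
Qed.

Lemma valV x : x \notin W -> x^-1 \in W.
Proof. by move=> Wx; case: W_valuation => _ /(_ x); rewrite (negPf Wx). Qed.

Lemma vunit1 : vunit 1.
Proof. by rewrite /vunit invr1 oner_eq0 val1. Qed.

Lemma vunit0 : vunit 0 = false.
Proof. by rewrite /vunit eqxx. Qed.

Lemma vunitV u : vunit u^-1 = vunit u.
Proof. by rewrite /vunit invr_eq0 invrK; case: (_ == 0) => //=; rewrite andbC. Qed.

Lemma vunitM u v : vunit u -> vunit v -> vunit (u * v).
Proof.
case/and3P=> u0 Wu Wu' /and3P[v0 Wv Wv'].
by rewrite /vunit mulf_neq0 // valM // invfM valM.
Qed.

Lemma vunitMr u v : vunit v -> vunit (u * v) = vunit u.
Proof.
move=> Uv; apply/idP/idP => [Uuv|Uu]; last exact: vunitM.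
by case/and3P: (Uv) => v0 _ _; rewrite -[u](mulfK v0) vunitM ?vunitV.
Qed.

Lemma vunitMl u v : vunit u -> vunit (u * v) = vunit v.
Proof. by move=> Uu; rewrite mulrC vunitMr. Qed.

Lemma vunitX u n : vunit u -> vunit (u ^+ n).
Proof.
by move=> Uu; elim: n => [|n IHn]; rewrite ?vunit1 // exprS vunitM.
Qed.

Lemma vmaxW u : vmax u -> u \in W.
Proof.
case/orP => [/eqP->|Wu]; first exact: val0.
by rewrite -[u]invrK valV.
Qed.

Lemma vunit_vmax u : vunit u -> vmax u = false.
Proof. by case/and3P => u0 _ Wu; rewrite /vmax (negPf u0) Wu. Qed.

Lemma val_vunit u : u \in W -> vunit u = ~~ vmax u.
Proof. by move=> Wu; rewrite /vunit /vmax Wu negb_or negbK. Qed.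

Lemma vmaxM w u : w \in W -> vmax u -> vmax (w * u).
Proof.
move=> Ww mu; rewrite /vmax; have [//|wu0] := eqVneq (w * u) 0.
apply/negP => Wwu; have [w0 u0] : w != 0 /\ u != 0.
  by apply/andP; rewrite -negb_or -mulf_eq0.
move: mu; rewrite /vmax (negPf u0) /= => /negP[].
by rewrite -[u^-1](mulKf w0) mulrCA -invfM valM.
Qed.

Lemma vmaxN u : vmax (- u) = vmax u.
Proof.
by rewrite /vmax oppr_eq0 invrN; congr (_ || ~~ _);
  apply/idP/idP => /valN; rewrite ?opprK.
Qed.

(** One of u / v and v / u lies in W, so the sum is a W-multiple of one of its terms. *)
Lemma vmaxD u v : vmax u -> vmax v -> vmax (u + v).
Proof.
have half x y : y != 0 -> x / y \in W -> vmax y -> vmax (x + y).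
  move=> y0 Wxy my; rewrite -[x](divfK y0) -[X in _ + X]mul1r -mulrDl.
  by rewrite vmaxM ?valD ?val1.
have [->|u0] := eqVneq u 0; first by rewrite add0r.
have [->|v0] := eqVneq v 0; first by rewrite addr0.
case: (boolP (u / v \in W)) => [Wuv _ mv|Wuv mu _]; first exact: half.
by rewrite addrC half // -[v / u]invrK invfM invrK mulrC valV.
Qed.

Lemma vunitD u v : vunit u -> vmax v -> vunit (u + v).
Proof.
move=> Uu mv; have Wu: u \in W by case/and3P: Uu.
have Wv := vmaxW mv; rewrite val_vunit ?valD //; apply/negP => muv.
by have := vunit_vmax Uu; rewrite -[u in vmax u](addrK v) vmaxD ?vmaxN.
Qed.

Lemma vunit_exp u n : (0 < n)%N -> vunit (u ^+ n) = vunit u.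
Proof.
move=> n_gt0; apply/idP/idP => [Uun|]; last exact: vunitX.
have u0: u != 0 by apply: contraTneq Uun => ->; rewrite expr0n gtn_eqF ?vunit0.
have vmaxX x : vmax x -> vmax (x ^+ n).
  by move=> mx; rewrite -(prednK n_gt0) exprSr vmaxM // valX ?vmaxW.
have [Wu|Wu] := boolP (u \in W).
  rewrite val_vunit //; apply/negP => /vmaxX.
  by rewrite vunit_vmax.
have: vmax (u^-1 ^+ n) by apply: vmaxX; rewrite /vmax invr_eq0 invrK Wu orbT.
by rewrite exprVn vunit_vmax ?vunitV.
Qed.

Definition vdvd (a b : L) : bool := (b == 0) || (a != 0) && (b / a \in W).

Lemma vdvdP a b : reflect (divides_in W a b) (vdvd a b).
Proof.
apply: (iffP idP) => [/orP[/eqP->|/andP[a0 Wba]]|[w Ww ->]].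
- by exists 0; rewrite ?mul0r ?val0.
- by exists (b / a); rewrite ?divfK.
have [->|wa0] := eqVneq (w * a) 0; first by rewrite /vdvd eqxx.
have a0: a != 0 by apply: contraNneq wa0 => ->; rewrite mulr0.
by rewrite /vdvd a0 mulfK // Ww orbT.
Qed.

Lemma vdvd_mul2l c a b : c != 0 -> vdvd (c * a) (c * b) = vdvd a b.
Proof.
move=> c0; rewrite /vdvd !mulf_eq0 (negPf c0) /=.
by have [->|a0] := eqVneq a 0; rewrite ?orbF //= -mulf_div divff ?mul1r.
Qed.

Lemma vdvd_vunit a b : a != 0 -> b != 0 -> vdvd a b && vdvd b a = vunit (b / a).
Proof.
move=> a0 b0; rewrite /vdvd (negPf a0) (negPf b0) /=.
by rewrite /vunit mulf_neq0 ?invr_eq0 //= invf_div.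
Qed.

(* [a] and [b] are the ends of the horizontal edge of the Newton polygon *)
Definition unit_range (a b : nat) (F : {poly L}) : Prop :=
  [/\ forall j, F`_j \in W, vunit F`_a, vunit F`_b
    & forall j, (j < a)%N || (b < j)%N -> vmax F`_j].

(** Modulo the maximal ideal, a factor 1 + zX is 1 when z is in that ideal and moves neither end;
    when z is a unit it moves only the upper end. When z is outside W, it is rewritten as z (z^-1 +
    X), where z goes into [c] and the rest reduces to X, moving both ends by one. *)
Lemma unit_range_prod (s : seq L) :
  exists2 c, c != 0 & exists2 F, \prod_(z <- s) (1 + z *: 'X) = c *: F &
    unit_range (count (fun z => z \notin W) s) (count (fun z => ~~ vmax z) s) F.
Proof.
elim: s => [|z s [c c0 [F defF [WF Fa Fb maxF]]]].
  exists 1; first exact: oner_neq0.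
  exists 1; rewrite ?big_nil ?scale1r //; split; rewrite ?coef1 ?vunit1 //=.
    by move=> j; rewrite coef1; case: eqP => _; [exact: val1|exact: val0].
  by case=> [|j] // _; rewrite coef1 /vmax eqxx.
rewrite big_cons defF /=.
set a := count _ s in Fa maxF *; set b := count _ s in Fb maxF *.
case: (boolP (z \in W)) => [Wz|Wz] /=; last first.
  have z0: z != 0 by apply: contraNneq Wz => ->; rewrite val0.
  have mz: vmax z^-1 by rewrite /vmax invrK Wz orbT.
  have ->: ~~ vmax z.
    by rewrite /vmax (negPf z0) /= negbK valV.
  exists (z * c); first exact: mulf_neq0.
  exists ((z^-1%:P + 'X) * F).
    have ->: 1 + z *: 'X = z *: (z^-1%:P + 'X).
      by rewrite scalerDr -[z *: z^-1%:P]mul_polyC -polyCM mulfV.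
    by rewrite -scalerAl -scalerAr scalerA.
  have coE j : ((z^-1%:P + 'X) * F)`_j.+1 = z^-1 * F`_j.+1 + F`_j.
    by rewrite mulrDl coefD coefCM coefXM.
  have co0 : ((z^-1%:P + 'X) * F)`_0 = z^-1 * F`_0.
    by rewrite mulrDl coefD coefCM coefXM addr0.
  have mzF j : vmax (z^-1 * F`_j) by rewrite mulrC vmaxM.
  split.
  - case=> [|j]; first by rewrite co0; apply: vmaxW.
    by rewrite coE; apply: valD => //; apply: vmaxW.
  - by rewrite coE addrC vunitD.
  - by rewrite coE addrC vunitD.
  - case=> [|j] jab; first by rewrite co0.
    by rewrite coE vmaxD // maxF.
exists c => //; exists ((1 + z *: 'X) * F); first by rewrite scalerAr.
have coE j : ((1 + z *: 'X) * F)`_j.+1 = F`_j.+1 + z * F`_j.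
  by rewrite mulrDl mul1r coefD -scalerAl coefZ coefXM.
have co0 : ((1 + z *: 'X) * F)`_0 = F`_0.
  by rewrite mulrDl mul1r coefD -scalerAl coefZ coefXM mulr0 addr0.
have [mz|nmz] /= := boolP (vmax z).
  have mzF j : vmax (z * F`_j) by rewrite mulrC vmaxM.
  have coU j : vunit F`_j -> vunit ((1 + z *: 'X) * F)`_j.
    by case: j => [|j] Uj; rewrite ?co0 ?coE ?vunitD.
  split; rewrite ?add0n; [|exact: coU|exact: coU|].
  - case=> [|j]; first by rewrite co0.
    by rewrite coE; apply: valD => //; apply: vmaxW.
  - case=> [|j] jab; first by rewrite co0 maxF.
    by rewrite coE vmaxD // maxF.
have Uz: vunit z by rewrite val_vunit.
split; rewrite ?add0n.
- case=> [|j]; first by rewrite co0.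
  by rewrite coE; apply: valD => //; apply: valM.
- case: (a) Fa maxF => [|a'] Fa maxF; rewrite ?co0 ?coE // vunitD // vmaxM //.
  by rewrite maxF // ltnSn.
- by rewrite coE addrC vunitD ?vunitM // maxF // ltnSn orbT.
- case=> [|j] jab; first by rewrite co0; apply: maxF; case/orP: jab => [->|].
  move: jab; rewrite add1n ltnS => jab.
  rewrite coE; apply: vmaxD => //; last apply: vmaxM => //; apply: maxF.
    by case/orP: jab => [->//|/ltnW]; rewrite ltnS => ->; rewrite orbT.
  by case/orP: jab => [/ltnW->//|->]; rewrite orbT.
Qed.

Lemma count_vunit (s : seq L) :
  count (fun z => ~~ vmax z) s =
    (count (fun z => z \notin W) s + count vunit s)%N.
Proof.
rewrite -count_predUI [X in (_ + X)%N](_ : _ = 0%N) ?addn0.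
  apply: eq_count => z /=; have [Wz|Wz] := boolP (z \in W) => /=.
    by rewrite val_vunit.
  rewrite /vmax valV // orbF; apply: contraNneq Wz => ->; exact: val0.
apply/eqP; rewrite -leqn0 leqNgt -has_count; apply/hasPn => z _ /=.
by rewrite negb_and negbK /vunit; case: (z \in W); rewrite ?andbF.
Qed.

End Valuation.

(** * Polynomials in a companion matrix *)

Section Spectrum.
Variable L : closedFieldType.

Definition hmx (d : nat) : 'M[L]_d -> {poly L} -> 'M[L]_d :=
  if d is d'.+1 then fun C p => horner_mx (C : 'M_d'.+1) p else fun _ _ => 0.

Section Hmx.
Variables (d : nat) (C : 'M[L]_d).

Lemma hmx0 : hmx C 0 = 0.
Proof. by case: d C => //= n A; rewrite rmorph0. Qed.

Lemma hmx1 : hmx C 1 = 1%:M.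
Proof. by case: d C => /= [A|n A]; rewrite ?flatmx0 ?thinmx0 ?rmorph1. Qed.

Lemma hmxX : hmx C 'X = C.
Proof. by case: d C => /= [A|n A]; rewrite ?horner_mx_X // [RHS]flatmx0. Qed.

Lemma hmxD p q : hmx C (p + q) = hmx C p + hmx C q.
Proof. by case: d C => /= [A|n A]; rewrite ?addr0 ?rmorphD. Qed.

Lemma hmxM p q : hmx C (p * q) = hmx C p *m hmx C q.
Proof. by case: d C => /= [A|n A]; rewrite ?mul0mx ?rmorphM. Qed.

Lemma hmxZ a p : hmx C (a *: p) = a *: hmx C p.
Proof. by case: d C => /= [A|n A]; rewrite ?scaler0 ?linearZ. Qed.

Lemma hmx_eigen (x : L) (v : 'cV_d) q :
  C *m v = x *: v -> hmx C q *m v = q.[x] *: v.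
Proof.
move=> Cv; elim/poly_ind: q => [|q a IHq].
  by rewrite hmx0 mul0mx horner0 scale0r.
rewrite hornerMXaddC hmxD hmxM hmxX -alg_polyC hmxZ hmx1 mulmxDl -mulmxA Cv.
by rewrite -scalemxAr IHq -scalemxAl mul1mx scalerA scalerDl mulrC.
Qed.

Variable rs : seq L.
Hypothesis char_C : char_poly C = \prod_(x <- rs) ('X - x%:P).

Lemma size_roots : size rs = d.
Proof.
by apply: succn_inj; rewrite -(size_prod_XsubC rs id) -char_C size_char_poly.
Qed.

(** By multiplicativity it suffices to treat the linear factors of q, and det (C - b) is the
    characteristic polynomial at b up to sign. *)
Lemma det_hmx q : \det (hmx C q) = \prod_(x <- rs) q.[x].
Proof.
have prodZ a (f : L -> L) :
  \prod_(x <- rs) (a * f x) = a ^+ d * \prod_(x <- rs) f x.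
  by rewrite -size_roots big_split big_const_seq count_predT iter_mulr_1.
have det_sub b : \det (hmx C ('X - b%:P)) = \prod_(x <- rs) (x - b).
  rewrite hmxD hmxX -scaleN1r -alg_polyC scalerA hmxZ hmx1.
  have ->: C + (-1 * b) *: 1%:M = -1 *: (b%:M - C).
    by rewrite scaleN1r opprB mulN1r scaleNr scalemx1.
  have {1}->: b%:M - C = map_mx (horner_eval b) (char_poly_mx C).
    apply/matrixP => i j.
    by rewrite !mxE /horner_eval !hornerE hornerMn hornerX.
  rewrite detZ det_map_mx -/(char_poly C) char_C [X in _ * X]horner_prod -prodZ.
  by apply: eq_bigr => x _; rewrite !hornerE mulN1r opprB.
have [r ->] := closed_field_poly_normal q.
rewrite hmxZ detZ; under [RHS]eq_bigr do rewrite hornerZ.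
rewrite prodZ; congr (_ * _).
elim: r => [|b r IHr].
  rewrite big_nil hmx1 det1 big1 // => x _; exact: hornerC.
rewrite big_cons hmxM det_mulmx det_sub IHr -big_split.
by apply: eq_bigr => x _; rewrite hornerM !hornerE.
Qed.

(** Both sides agree at every point t, by [det_hmx] for 1 + t q. Their difference [D] vanishes
    everywhere, so 1 + D has no root in the closed field and is constant. *)
Lemma det_one_add q :
  \det (1%:M + 'X *: map_mx polyC (hmx C q)) =
  \prod_(x <- rs) (1 + q.[x] *: 'X).
Proof.
apply/eqP; rewrite -subr_eq0; set D := _ - _.
have D0 t : D.[t] = 0.
  rewrite /D hornerD hornerN horner_prod -horner_evalE -det_map_mx.
  rewrite [X in \det X](_ : _ = hmx C (1 + t *: q)); last first.
    rewrite hmxD hmxZ hmx1; apply/matrixP => i j.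
    by rewrite !mxE rmorphD rmorphM rmorph_nat /= /horner_eval hornerX hornerC.
  rewrite det_hmx; apply/eqP; rewrite subr_eq0; apply/eqP.
  by apply: eq_bigr => x _; rewrite !hornerE mulrC.
move: D D0 => {}D D0; have szD: size (1 + D) == 1.
  apply: contraT => /closed_rootP[t]; rewrite /root !hornerE D0 addr0.
  by rewrite oner_eq0.
have {szD} /size_poly1P[a _ Da] := szD.
have := D0 0; rewrite -[D](addKr 1) Da !hornerE => a1.
have -> : -1 + a%:P = (-1 + a)%:P by rewrite polyCD polyCN.
by rewrite a1.
Qed.

End Hmx.

(** The size [d] is a parameter, tied to the degree by hypotheses only, which avoids casts between
    matrix types. *)
Definition companion (d : nat) (P : {poly L}) : 'M[L]_d :=
  \matrix_(i, j) if i.+1 == d then - P`_j else (i.+1 == j)%:R.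

Lemma char_poly_companion d (P : {poly L}) :
  P \is monic -> size P = d.+1 -> char_poly (companion d P) = P.
Proof.
move=> monP szP; have Ed: d = (size P).-1 by rewrite szP.
subst d; rewrite -[RHS]companionmxK //; congr (char_poly _).
have n_gt0 (i : 'I_(size P).-1) : (0 < (size P).-1)%N.
  exact: leq_ltn_trans (leq0n i) (ltn_ord i).
apply/matrixP => i j; rewrite !mxE.
by rewrite -[in RHS](eqSS i) prednK ?(n_gt0 i).
Qed.

Lemma companion_eigen d (P : {poly L}) (x : L) :
  P \is monic -> size P = d.+1 -> root P x ->
  companion d P *m \col_i x ^+ i = x *: \col_i x ^+ i.
Proof.
move=> monP szP /rootP Px0; apply/colP => i; rewrite !mxE -exprS.
under eq_bigr do rewrite !mxE.
have [id|id] := eqVneq i.+1 d.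
  have := Px0; rewrite horner_coef szP big_ord_recr /=.
  have ->: P`_d = 1 by move/monicP: monP; rewrite /lead_coef szP.
  rewrite mul1r addrC => /eqP; rewrite addr_eq0 id => /eqP->.
  by rewrite -sumrN; apply: eq_bigr => j _; rewrite mulNr.
have id' : (i.+1 < d)%N by rewrite ltn_neqAle id ltn_ord.
rewrite (bigD1 (Ordinal id')) //= eqxx mul1r big1 ?addr0 // => j.
by rewrite -val_eqE /= eq_sym => /negPf->; rewrite mul0r.
Qed.

End Spectrum.

(** * Correctness of the algorithm *)

(** Entries contain functions and have no decidable equality, so the predicates of [List] stand in
    for membership. *)
Lemma Forall_cat (T : Type) (Q : T -> Prop) s t :
  List.Forall Q s -> List.Forall Q t -> List.Forall Q (s ++ t).
Proof. by elim=> //= x {}s Qx _ IHs Qt; constructor=> //; apply: IHs. Qed.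

Lemma Exists_cat (T : Type) (Q : T -> Prop) s t :
  List.Exists Q s \/ List.Exists Q t -> List.Exists Q (s ++ t).
Proof.
case=> [|Qt]; first by elim=> [x {}s Qx|x {}s _ IHs]; constructor.
by elim: s => //= x s IHs; constructor.
Qed.

Lemma sumn_count_exchange (A B : Type) (h : A -> B -> bool) s t :
  sumn [seq count (h a) t | a <- s] = sumn [seq count (h^~ b) s | b <- t].
Proof.
elim: t => [|b t IHt] /=; first by elim: s.
by rewrite -IHt; elim: s {IHt} => //= a s ->; rewrite addnACA.
Qed.

Lemma Forall2_cat (A B : Type) (Q : A -> B -> Prop) s1 s2 t1 t2 :
  List.Forall2 Q s1 t1 -> List.Forall2 Q s2 t2 ->
  List.Forall2 Q (s1 ++ s2) (t1 ++ t2).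
Proof. by elim=> //= x y s t Qxy _ IHs Q2; constructor=> //; apply: IHs. Qed.

Lemma Forall2_nseq_filter (A : Type) (B : eqType) (Q : A -> B -> Prop)
    (p : pred B) s a :
  (forall x, x \in s -> p x -> Q a x) ->
  List.Forall2 Q (nseq (count p s) a) (filter p s).
Proof.
elim: s => [|x s IHs] Qa /=; first by constructor.
have {}IHs : List.Forall2 Q (nseq (count p s) a) (filter p s).
  by apply: IHs => y sy; apply: Qa; rewrite inE sy orbT.
case: (boolP (p x)) => //= px; constructor=> //.
by apply: Qa; rewrite ?mem_head.
Qed.

Lemma foldr_maxn (I : seq nat) b :
  b \in I -> (forall j, j \in I -> (j <= b)%N) -> foldr maxn 0%N I = b.
Proof.
move=> Ib ubI; apply/eqP; rewrite eqn_leq; apply/andP; split.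
  elim: I ubI {Ib} => //= i I IHI ubI; rewrite geq_max ubI ?mem_head //=.
  by apply: IHI => j Ij; rewrite ubI // inE Ij orbT.
elim: I Ib {ubI} => //= i I IHI; rewrite inE leq_max => /orP[/eqP->|/IHI->].
  by rewrite leqnn.
by rewrite orbT.
Qed.

Lemma foldr_minn (I : seq nat) a d :
  a \in d :: I -> (forall j, j \in d :: I -> (a <= j)%N) -> foldr minn d I = a.
Proof.
move=> Ia lbI; apply/eqP; rewrite eqn_leq; apply/andP; split; last first.
  elim: I lbI {Ia} => [|i I IHI] lbI /=; first by rewrite lbI ?mem_head.
  rewrite leq_min lbI ?inE ?eqxx ?orbT //=; apply: IHI => j.
  by rewrite inE => /orP[/eqP->|Ij]; rewrite lbI // !inE ?eqxx ?Ij ?orbT.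
elim: I Ia {lbI} => [|i I IHI] /=; first by rewrite inE => /eqP->.
rewrite !inE geq_min orbCA => /orP[/eqP->|]; first by rewrite leqnn.
by move=> Ia; rewrite IHI ?orbT // inE.
Qed.

Section Correctness.
Variables (k : ctx) (L : closedFieldType) (W : {pred L}).
Local Notation R := {mpoly int[cn k]}.
Local Notation matrixf := (nat -> nat -> R).
Local Notation polyf := (nat -> R).
Local Notation value := (nat * (R * R))%type.
Local Notation coordinate := (R * (matrixf * seq value))%type.
Variable phi : {rmorphism R -> L}.
Hypothesis W_valuation : valuation_ring W.
Hypothesis is_zeroE : forall f : R, is_zero f = (phi f == 0).
Hypothesis dividesE : forall f g : R, divides f g = vdvd W (phi f) (phi g).

(** * Determinants and minimal indices, read through [phi] *)

Lemma sumfE n (f : nat -> R) : sumf n f = \sum_(i < n) f i.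
Proof.
rewrite /sumf -(big_mkord xpredT) /index_iota subn0.
by elim: (iota 0 n) => [|i s IHs]; rewrite ?big_nil ?big_cons //= IHs.
Qed.

Lemma detpS n (A : nat -> nat -> polyf) m :
  detp n.+1 A m = sumf n.+1 (fun i => (-1) ^+ i * mulp (A i 0%N)
    (detp n (fun a b => A (if (i <= a)%N then a.+1 else a) b.+1)) m).
Proof. by []. Qed.

Lemma detp_coef n (A : nat -> nat -> polyf) (B : nat -> nat -> {poly L}) m :
  (forall i j l, phi (A i j l) = (B i j)`_l) ->
  phi (detp n A m) = (\det (\matrix_(i < n, j < n) B i j))`_m.
Proof.
elim: n A B m => [|n IHn] A B m AB.
  by rewrite det_mx00 coef1 /detp /=; case: eqP; rewrite ?rmorph1 ?rmorph0.
rewrite detpS sumfE rmorph_sum /= (expand_det_col _ ord0) coef_sum.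
apply: eq_bigr => i _; rewrite /mulp sumfE rmorphM rmorph_sign rmorph_sum /=.
rewrite /cofactor mxE addn0 mulrCA -[(-1) ^+ i in RHS](rmorph_sign polyC).
rewrite coefCM coefM; congr (_ * _); apply: eq_bigr => l _.
rewrite rmorphM AB; congr (_ * _).
rewrite (IHn _ (fun a b => B (bump i a) b.+1)); last first.
  by move=> a b l'; rewrite AB /bump; case: leqP; rewrite ?add1n ?add0n.
by congr (polyseq (\det _))`_ _; apply/matrixP => a b; rewrite !mxE.
Qed.

(** The common factor [c] does not affect divisibility. As all F_j lie in W and F_a is a unit, the
    minimal indices are exactly those where F_j is a unit. *)
Lemma spread_unit_range d (h : polyf) (F : {poly L}) c a b :
  c != 0 -> (forall j, (j <= d)%N -> phi (h j) = c * F`_j) ->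
  unit_range W a b F -> (a <= b <= d)%N -> spread d h = (b - a)%N.
Proof.
move=> c0 hF [WF Fa Fb maxF] /andP[le_ab le_bd].
rewrite /spread (_ : filter _ _ = [seq j <- iota 0 d.+1 | vunit W F`_j]); last first.
  apply: eq_in_filter => j; rewrite mem_iota add0n ltnS => /andP[_ le_jd].
  apply/allP/idP => [/(_ a)|Uj l].
    rewrite mem_iota add0n ltnS (leq_trans le_ab) // => /(_ isT).
    rewrite dividesE !hF ?(leq_trans le_ab) // vdvd_mul2l //.
    have Fa0: F`_a != 0 by case/and3P: Fa.
    rewrite /vdvd (negPf Fa0) => /andP[Fj0 WFaj].
    rewrite val_vunit //; apply/negP => mj.
    by have := vunit_vmax Fa; rewrite -(divfK Fj0 F`_a) vmaxM.
  rewrite mem_iota add0n ltnS => /andP[_ le_ld].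
  rewrite dividesE !hF // vdvd_mul2l // /vdvd.
  case/and3P: Uj => -> _ WVj; apply/orP; right; exact: valM.
have unit_in j : vunit W F`_j -> (a <= j <= b)%N.
  move=> Uj; rewrite leqNgt [(j <= b)%N]leqNgt -negb_or; apply/negP => /maxF.
  by rewrite vunit_vmax.
move: (filter _ _) (mem_filter (fun j => vunit W F`_j) ^~ (iota 0 d.+1)) => I memI.
have inI j : (j \in I) = (vunit W F`_j).
  rewrite memI mem_iota add0n ltnS; case: (boolP (vunit _ _)) => //= Uj.
  by case/andP: (unit_in j Uj) => _ le_jb; apply: leq_trans le_bd.
have Iab j : j \in I -> (a <= j <= b)%N by rewrite inI; apply: unit_in.
rewrite (@foldr_maxn I b) ?inI //; last by move=> j /Iab/andP[].
rewrite (@foldr_minn I a) ?inE ?inI ?Fa ?orbT // => j.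
rewrite inE => /orP[/eqP->|/Iab/andP[] //]; exact: leq_trans le_bd.
Qed.

(** * Matrices representing polynomials in the companion matrix *)

Variables (P : {poly L}) (d : nat) (rs : seq L).
Hypothesis P_monic : P \is monic.
Hypothesis size_P : size P = d.+1.
Hypothesis P_split : P = \prod_(x <- rs) ('X - x%:P).

Let C : 'M[L]_d := companion d P.

Let char_C : char_poly C = \prod_(x <- rs) ('X - x%:P).
Proof. by rewrite char_poly_companion. Qed.

Let size_rs : size rs = d.
Proof. exact: size_roots char_C. Qed.

Definition represents (M : matrixf) (q : {poly L}) : Prop :=
  \matrix_(i < d, j < d) phi (M i j) = hmx C q.

Lemma represents_onem : represents (@onem k) 1.
Proof.
rewrite /represents hmx1; apply/matrixP => i j; rewrite !mxE /onem -val_eqE.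
by case: eqP; rewrite ?rmorph1 ?rmorph0.
Qed.

Lemma represents_mulm A B p q :
  represents A p -> represents B q -> represents (mulm d A B) (p * q).
Proof.
rewrite /represents hmxM => <- <-; apply/matrixP => i j.
rewrite !mxE /mulm sumfE rmorph_sum; apply: eq_bigr => l _.
by rewrite !mxE rmorphM.
Qed.

Lemma represents_expm M q m :
  represents M q -> represents (expm d M m) (q ^+ m).
Proof.
move=> Mq; elim: m => [|m IHm]; first exact: represents_onem.
by rewrite exprS; apply: represents_mulm.
Qed.

Lemma charf_coef M q m : represents M q ->
  phi (charf d M m) = (\prod_(x <- rs) (1 + q.[x] *: 'X))`_m.
Proof.
move=> Mq; rewrite -(det_one_add char_C) /charf.
rewrite (@detp_coef _ _
  (fun i j => (i == j)%:R%:P + (phi (M i j))%:P * 'X)); last first.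
  move=> i j l; rewrite coefD coefC coefCM coefX /onem.
  case: l => [|[|l]] /=; rewrite ?mulr0 ?mulr1 ?add0r ?addr0 ?rmorph0 //.
  by case: eqP; rewrite ?rmorph1 ?rmorph0.
congr (polyseq (\det _))`_ _; rewrite -Mq; apply/matrixP => i j.
by rewrite !mxE rmorph_nat mulrC.
Qed.

(* The first row determines the value of the represented polynomial, since
   (1, x, x^2, ...) is an eigenvector of the companion matrix. *)
Definition eval_at (M : matrixf) (x : L) : L :=
  \sum_(l < d) phi (M 0%N l) * x ^+ l.

Lemma eval_atE M q x : represents M q -> x \in rs -> eval_at M x = q.[x].
Proof.
move=> Mq rs_x; have Px: root P x by rewrite P_split root_prod_XsubC.
have := hmx_eigen q (companion_eigen P_monic size_P Px); rewrite -/C -Mq.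
have d_gt0: (0 < d)%N by rewrite -size_rs; case: (rs) rs_x.
move/colP/(_ (Ordinal d_gt0)); rewrite !mxE expr0 mulr1 => <-.
by apply: eq_bigr => l _; rewrite !mxE.
Qed.

Definition good (M : matrixf) : Prop := exists q, represents M q.

Lemma good_onem : good (@onem k).
Proof. by exists 1; apply: represents_onem. Qed.

Lemma good_mulm A B : good A -> good B -> good (mulm d A B).
Proof. by move=> [p Ap] [q Bq]; exists (p * q); apply: represents_mulm. Qed.

Lemma good_expm M m : good M -> good (expm d M m).
Proof. by move=> [q Mq]; exists (q ^+ m); apply: represents_expm. Qed.

Lemma eval_onem x : x \in rs -> eval_at (@onem k) x = 1.
Proof. by move=> rs_x; rewrite (eval_atE represents_onem) // hornerC. Qed.

Lemma eval_mulm A B x : good A -> good B -> x \in rs ->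
  eval_at (mulm d A B) x = eval_at A x * eval_at B x.
Proof.
move=> [p Ap] [q Bq] rs_x; rewrite (eval_atE (represents_mulm Ap Bq)) //.
by rewrite (eval_atE Ap) // (eval_atE Bq) // hornerM.
Qed.

Lemma eval_expm M m x : good M -> x \in rs ->
  eval_at (expm d M m) x = eval_at M x ^+ m.
Proof.
move=> [q Mq] rs_x; rewrite (eval_atE (represents_expm m Mq)) //.
by rewrite (eval_atE Mq) // horner_exp.
Qed.

(** Substitution of aX for X. *)
Lemma coef_prod_scale (a : L) (s : seq L) m :
  (\prod_(z <- s) (1 + (a * z) *: 'X))`_m =
  a ^+ m * (\prod_(z <- s) (1 + z *: 'X))`_m.
Proof.
elim: s m => [|z s IHs] m.
  by rewrite !big_nil coef1; case: m => [|m]; rewrite ?mulr0 ?mulr1 ?expr0.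
rewrite !big_cons !mulrDl !mul1r -!scalerAl !coefD !coefZ !coefXM IHs.
case: m => [|m] /=; first by rewrite !mulr0 !addr0.
by rewrite IHs exprS mulrDr; congr (_ + _); rewrite !mulrA; congr (_ * _);
  rewrite mulrAC (mulrC a) -!mulrA mulrCA.
Qed.

(** * Counting the roots at which several elements are units *)

Definition good_entry (a : matrixf * (R * R)) : Prop :=
  [/\ good a.1, phi a.2.1 != 0 & phi a.2.2 != 0].

Definition entry_at (a : matrixf * (R * R)) (x : L) : L :=
  phi a.2.1 * eval_at a.1 x / phi a.2.2.

Lemma count_units_correct a : good_entry a ->
  count_units d a = count (fun x => vunit W (entry_at a x)) rs.
Proof.
case: a => M [f g] [/= [q Mq] f0 g0].
have [c c0 [F defF rangeF]] := unit_range_prod W_valuation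
  [seq entry_at (M, (f, g)) x | x <- rs].
rewrite /count_units /=.
(* Here [c] normalizes the product of the factors and [phi g ^+ d] is the cleared denominator. *)
rewrite (@spread_unit_range d _ F (phi g ^+ d * c) _ _ _ _ rangeF).
- by rewrite (count_vunit W_valuation) addKn count_map.
- by rewrite mulf_neq0 ?expf_neq0.
- move=> j le_jd; rewrite !rmorphM !rmorphXn (charf_coef _ Mq).
  rewrite -[RHS]mulrA -coefZ -defF.
  rewrite big_map [in RHS](eq_big_seq (fun x => 1 + (phi f / phi g * q.[x]) *: 'X)).
    rewrite -(big_map (fun x => q.[x]) xpredT
      (fun z => 1 + (phi f / phi g * z) *: 'X)) coef_prod_scale big_map.
    have ->: phi g ^+ d = phi g ^+ (d - j) * phi g ^+ j by rewrite -exprD subnK.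
    move: (_`_j) => e; rewrite expr_div_n -!mulrA [phi g ^+ j * _]mulrCA mulVKf ?expf_neq0 //.
    by rewrite mulrC mulrA [X in X * e]mulrC.
  by move=> x rs_x; rewrite /entry_at /= (eval_atE Mq) // mulrAC.
- rewrite (count_vunit W_valuation) leq_addr /=.
  by rewrite -(count_vunit W_valuation) (leq_trans (count_size _ _)) ?size_map ?size_rs.
Qed.


(* Otherwise every exponent [N <= d] fails at some point; two exponents then
   fail at the same point, where the ratio of both products is a power of [w]. *)
Lemma separating_exponent (u w : L -> L) :
  exists2 N, (N <= d)%N & forall x, x \in rs ->
    vunit W (u x * w x ^+ N) -> vunit W (u x) && vunit W (w x).
Proof.
pose bad N x := vunit W (u x * w x ^+ N) && ~~ (vunit W (u x) && vunit W (w x)).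
case: (boolP (all (fun N => has (bad N) rs) (iota 0 d.+1))); last first.
  case/allPn => N; rewrite mem_iota add0n ltnS => /andP[_ le_Nd] /hasPn goodN.
  by exists N => // x /goodN; rewrite negb_and negbK; case: (vunit _ _).
move=> /allP all_bad; exfalso.
pose f N := find (bad N) rs.
have f_lt N : (N <= d)%N -> (f N < d)%N.
  by move=> le_Nd; rewrite -size_rs -has_find all_bad // mem_iota.
have not_uniq : ~~ uniq (map f (iota 0 d.+1)).
  apply/negP => uniq_f; have := uniq_leq_size uniq_f (s2 := iota 0 d).
  rewrite size_map !size_iota ltnn => /(_ _)/notF; apply.
  move=> i /mapP[N]; rewrite mem_iota add0n ltnS => /andP[_ le_Nd] ->.
  by rewrite mem_iota f_lt.
have [i [j [lt_ij]]] := uniqPn 0%N not_uniq.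
rewrite size_map size_iota => lt_jd.
have lt_id := ltn_trans lt_ij lt_jd.
rewrite !(nth_map 0%N) ?size_iota // !nth_iota // !add0n => eq_f.
have bad_f N : (N < d.+1)%N -> bad N (nth 0 rs (f N)).
  by move=> lt_Nd; apply: nth_find; rewrite all_bad // mem_iota.
have := bad_f j lt_jd; rewrite -eq_f => /andP[Uj _].
have /andP[Ui /negP[]] := bad_f i lt_id; move: (nth _ _ _) => x in Ui Uj *.
have Uw: vunit W (w x).
  rewrite -(@vunit_exp _ _ W_valuation _ (j - i)) ?subn_gt0 //.
  rewrite -(vunitMl W_valuation _ Ui) -mulrA -exprD subnKC //; exact: ltnW.
by rewrite Uw andbT -(vunitMr W_valuation _ (vunitX W_valuation i Uw)).
Qed.

Definition all_units (s : seq (matrixf * (R * R))) (x : L) : bool :=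
  all (fun a => vunit W (entry_at a x)) s.

Lemma good_mul_exp a b m :
  good_entry a -> good_entry b -> good_entry (mul_exp d a b m).
Proof.
case=> ga fa0 ha0 [gb fb0 hb0]; split.
- by apply: good_mulm => //; apply: good_expm.
- by rewrite /= rmorphM rmorphXn mulf_neq0 ?expf_neq0.
- by rewrite /= rmorphM rmorphXn mulf_neq0 ?expf_neq0.
Qed.

Lemma mul_exp_at a b m x : good_entry a -> good_entry b -> x \in rs ->
  entry_at (mul_exp d a b m) x = entry_at a x * entry_at b x ^+ m.
Proof.
case=> ga fa0 ha0 [gb fb0 hb0] rs_x; rewrite /entry_at /=.
rewrite eval_mulm ?eval_expm //; last exact: good_expm.
rewrite !rmorphM !rmorphXn !exprMn exprVn invfM.
by rewrite [X in X * _ = _]mulrACA [LHS]mulrACA.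
Qed.

Lemma combinations_cons (a : matrixf * (R * R)) s : combinations d (a :: s) =
  flatten [seq [seq mul_exp d a b N | N <- iota 0 d.+1] | b <- combinations d s].
Proof. by []. Qed.

(** Products of powers of units are units, so no combination undercounts. *)
Lemma combinations_sound s : List.Forall good_entry s ->
  List.Forall (fun b => good_entry b /\
    forall x, x \in rs -> all_units s x -> vunit W (entry_at b x))
  (combinations d s).
Proof.
elim: s => [|a s IHs] good_s.
  constructor=> //; split.
    by split; rewrite /= ?rmorph1 ?oner_neq0 //; apply: good_onem.
  move=> x rs_x _; rewrite /entry_at /= eval_onem // !rmorph1 mulr1 divr1.
  exact: vunit1.
case/List.Forall_cons_iff: good_s => good_a /IHs; rewrite combinations_cons.
move: (combinations d s) (iota 0 d.+1) => r I; elim: r => //= b r IHr.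
case/List.Forall_cons_iff => -[good_b Ub] /IHr Ur.
apply: Forall_cat => //; elim: I {IHr Ur} => //= N I IHI; constructor=> //.
split; first exact: good_mul_exp.
move=> x rs_x /andP[Ua Us]; rewrite mul_exp_at // vunitM ?vunitX //.
exact: Ub.
Qed.

(** [separating_exponent] is applied to the head and to a combination already exact for the tail. *)
Lemma combinations_complete s : List.Forall good_entry s ->
  List.Exists (fun b => good_entry b /\
    forall x, x \in rs -> vunit W (entry_at b x) -> all_units s x)
  (combinations d s).
Proof.
elim: s => [|a s IHs] good_s.
  constructor; split=> //.
  by split; rewrite /= ?rmorph1 ?oner_neq0 //; apply: good_onem.
case/List.Forall_cons_iff: good_s => good_a /IHs; rewrite combinations_cons.
have iotaP N : (N <= d)%N -> N \in iota 0 d.+1 by rewrite mem_iota.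
move: (combinations d s) (iota 0 d.+1) iotaP => r I memI.
elim: r => [|b r IHr] /=; first by case/List.Exists_nil.
case/List.Exists_cons => [[good_b Ub]|/IHr Ur]; apply: Exists_cat; last by right.
left; have [N /memI] := separating_exponent (entry_at a) (entry_at b).
elim: I {memI IHr} => // M I IHI; rewrite inE => /orP[/eqP<- sepN|IN sepN] /=.
  apply: List.Exists_cons_hd; split; first exact: good_mul_exp.
  move=> x rs_x; rewrite mul_exp_at // => /(sepN x rs_x)/andP[-> Ubx].
  exact: Ub.
by apply: List.Exists_cons_tl; apply: IHI.
Qed.

(** Soundness bounds the minimum from below and completeness shows that it is attained; its starting
    value [d] is harmless because there are d roots. *)
Lemma count_all_units_correct s : List.Forall good_entry s ->
  count_all_units d s = count (all_units s) rs.
Proof.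
move=> good_s; rewrite /count_all_units.
have := combinations_sound good_s; have := combinations_complete good_s.
move: (combinations d s) => r complete sound; apply: foldr_minn.
  rewrite inE; apply/orP; right; elim: r complete sound => [/List.Exists_nil//|b r IHr].
  move=> complete /List.Forall_cons_iff[[good_b soundb] sound]; rewrite inE.
  case/List.Exists_cons: complete => [[_ completeb]|/IHr-> //]; last exact: orbT.
  rewrite count_units_correct //; apply/orP; left; apply/eqP.
  by apply: eq_in_count => x rs_x; apply/idP/idP; [apply: soundb|apply: completeb].
move=> j; rewrite inE => /orP[/eqP->|]; first by rewrite -size_rs count_size.
elim: r sound {complete} => // b r IHr /List.Forall_cons_iff[[good_b soundb] /IHr sound].
rewrite inE => /orP[/eqP->|//]; rewrite count_units_correct //.
rewrite (@eq_in_count _ _ (fun x => all_units s x && vunit W (entry_at b x))).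
  by apply: sub_count => x /andP[].
by move=> x rs_x; case: (boolP (all_units s x)) => //= /(soundb x rs_x).
Qed.


(** * Candidate values *)

Definition finite_value (v : value) : Prop :=
  [/\ (0 < v.1)%N, phi v.2.1 != 0 & phi v.2.2 != 0].

Definition has_value (v : value) (y : L) : bool :=
  if phi v.2.2 == 0 then y == 0 else vunit W (phi v.2.1 * y ^+ v.1 / phi v.2.2).

Lemma has_value_neq0 v y : finite_value v -> has_value v y -> y != 0.
Proof.
case=> v_gt0 f0 g0; rewrite /has_value (negPf g0); apply: contraTneq => ->.
by rewrite expr0n gtn_eqF // mulr0 mul0r vunit0.
Qed.

Lemma slopes_finite M v : v \in slopes d M -> finite_value v.
Proof.
rewrite mem_filter !is_zeroE => /andP[/andP[f0 g0] /flattenP[l /mapP[j _ ->]]].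
by case/mapP=> s _ def_v; split=> //; rewrite def_v.
Qed.

(** Dividing all q(z) by y = q(x) puts the unit 1 into [s], so the horizontal edge from [a] to [b]
    has positive length. Undoing the scaling multiplies coefficient j by y^j, whence c_a y^(b-a) /
    c_b is a unit, c_j denoting the coefficients of [charf]. *)
Lemma slopes_complete M x : good M -> x \in rs -> eval_at M x != 0 ->
  has (has_value^~ (eval_at M x)) (slopes d M).
Proof.
move=> [q Mq] rs_x; rewrite (eval_atE Mq rs_x); set y := q.[x] => y0.
pose s := [seq y^-1 * q.[z] | z <- rs].
have [c c0 [F defF]] := unit_range_prod W_valuation s.
set a := count _ s; set b := count _ s => -[WF Fa Fb maxF].
have lt_ab : (a < b)%N.
  rewrite /b (count_vunit W_valuation) -[X in (X < _)%N]addn0 ltn_add2l -has_count.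
  apply/hasP; exists 1; last exact: vunit1.
  by apply/mapP; exists x => //; rewrite mulVf.
have le_bd : (b <= d)%N.
  by rewrite -size_rs -(size_map (fun z => y^-1 * q.[z])) count_size.
have charE j : phi (charf d M j) = y ^+ j * (c * F`_j).
  rewrite -coefZ -defF big_map -(big_map (fun z => q.[z]) xpredT
      (fun z => 1 + (y^-1 * z) *: 'X)) coef_prod_scale big_map.
  by rewrite exprVn mulVKf ?expf_neq0 // (charf_coef _ Mq).
have [Fa0 Fb0] : F`_a != 0 /\ F`_b != 0.
  by case/and3P: Fa => ? _ _; case/and3P: Fb.
have ea0: phi (charf d M a) != 0 by rewrite charE !mulf_neq0 ?expf_neq0.
have eb0: phi (charf d M b) != 0 by rewrite charE !mulf_neq0 ?expf_neq0.
apply/hasP; exists ((b - a)%N, (charf d M a, charf d M b)).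
  rewrite mem_filter !is_zeroE; apply/andP; split; first by rewrite ea0.
  apply/flatten_mapP; exists a.
    by rewrite mem_iota ltnS (leq_trans _ le_bd) // ltnW.
  apply/mapP; exists (b - a).-1; last by rewrite prednK ?subn_gt0 // subnKC // ltnW.
  by rewrite mem_iota ltnS (leq_trans (leq_pred _)) // (leq_trans (leq_subr _ _)).
rewrite /has_value /= (negPf eb0) !charE.
have ->: y ^+ b = y ^+ a * y ^+ (b - a) by rewrite -exprD subnKC // ltnW.
rewrite (_ : _ / _ = F`_a / F`_b) ?vunitM ?vunitV //.
have ya0: y ^+ a != 0 by rewrite expf_neq0.
have yb0: y ^+ (b - a) != 0 by rewrite expf_neq0.
by field; rewrite ya0 yb0 c0 Fb0.
Qed.

(** Both conditions are raised to the common exponent m m', where y cancels; by [vunit_exp] this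
    loses nothing. *)
Lemma same_valueE v w y : finite_value v -> finite_value w ->
  has_value v y -> same_value v w = has_value w y.
Proof.
move=> fin_v fin_w vy; have y0 := has_value_neq0 fin_v vy; move: vy.
case: v w fin_v fin_w => [m [f g]] [m' [f' g']] [/= m_gt0 f0 g0] [/= m'_gt0 f'0 g'0].
rewrite /has_value /same_value /= (negPf g0) (negPf g'0) => Uv.
rewrite !dividesE !rmorphM !rmorphXn vdvd_vunit ?mulf_neq0 ?expf_neq0 //.
rewrite -[RHS](vunit_exp W_valuation _ m_gt0) -[LHS]vunitV.
rewrite -[RHS](vunitMr W_valuation _ (vunitX W_valuation m' (etrans (vunitV _ _) Uv))).
congr (vunit W _); rewrite exprVn !expr_div_n !exprMn -!exprM [(m * m')%N]mulnC.
have n0 : [/\ phi f ^+ m' != 0, phi g ^+ m' != 0, phi f' ^+ m != 0,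
  phi g' ^+ m != 0 & y ^+ (m' * m) != 0] by rewrite !expf_neq0.
case: n0; do 5 move: (_ ^+ _) => ?.
move=> n1 n2 n3 n4 n5.
by field; rewrite n1 n2 n3 n4 n5.
Qed.

Lemma distinct_values_sub (s : seq value) : {subset distinct_values s <= s}.
Proof.
elim: s => //= v s IHs w; case: ifP => _; rewrite !inE.
  by move/IHs->; rewrite orbT.
by case/orP=> [->//|/IHs->]; rewrite orbT.
Qed.

(** Once [v] fits y, having the same value as [v] amounts to fitting y, so just one fitting
    representative is kept. *)
Lemma count_distinct_values (s : seq value) y : {in s, forall v, finite_value v} ->
  count (has_value^~ y) (distinct_values s) = has (has_value^~ y) s.
Proof.
elim: s => //= v s IHs fin_s.
have fin_v : finite_value v by apply: fin_s; rewrite mem_head.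
have fin_w w : w \in distinct_values s -> finite_value w.
  by move/distinct_values_sub => ws; apply: fin_s; rewrite inE ws orbT.
have {}IHs : count (has_value^~ y) (distinct_values s) = has (has_value^~ y) s.
  by apply: IHs => w ws; apply: fin_s; rewrite inE ws orbT.
have hasE : has_value v y ->
    has (same_value v) (distinct_values s) = has (has_value^~ y) (distinct_values s).
  by move=> vy; apply: eq_in_has => w /fin_w fw; apply: same_valueE.
have hasI : has (has_value^~ y) (distinct_values s) = has (has_value^~ y) s.
  by rewrite has_count IHs lt0b.
case: ifP => has_v /=; rewrite IHs.
  by case: (boolP (has_value v y)) => // vy; rewrite -hasI -hasE // has_v.
case: (boolP (has_value v y)) => // vy.
by rewrite -hasI -hasE // has_v.
Qed.

(** * Multiplicities of tuples of values *)

(** The last clause makes the subtraction for oo exact: each root with a nonzero value is removed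
    once and no other root is removed. *)
Definition good_coordinate (X : coordinate) : Prop :=
  [/\ good X.2.1, {in X.2.2, forall v, finite_value v} &
      {in rs, forall x, count (has_value^~ (eval_at X.2.1 x)) X.2.2
                        = (eval_at X.2.1 x != 0)}].

Lemma good_coordinate_slopes (kappa : R) M : good M ->
  good_coordinate (kappa, (M, distinct_values (slopes d M))).
Proof.
move=> gM; have fin v : v \in slopes d M -> finite_value v by apply: slopes_finite.
split=> //= [v /distinct_values_sub/fin //|x rs_x].
rewrite count_distinct_values //; congr nat_of_bool.
apply/idP/idP => [/hasP[v /fin fv]|]; first exact: has_value_neq0.
exact: slopes_complete.
Qed.

Definition good_choice (xv : coordinate * value) : Prop :=
  [/\ good_coordinate xv.1, (0 < xv.2.1)%N & phi xv.2.2.1 != 0].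

Lemma good_normalized M v :
  good M -> finite_value v -> good_entry (normalized d M v).
Proof. by move=> gM [v_gt0 f0 g0]; split=> //; apply: good_expm. Qed.

Lemma normalized_at M v x : good M -> finite_value v -> x \in rs ->
  vunit W (entry_at (normalized d M v) x) = has_value v (eval_at M x).
Proof.
move=> gM [v_gt0 f0 g0] rs_x.
by rewrite /has_value (negPf g0) /entry_at /= eval_expm.
Qed.

Definition agrees (t : seq (coordinate * value)) (x : L) : bool :=
  all (fun xv => has_value xv.2 (eval_at xv.1.2.1 x)) t.

Lemma multiplicity_correct t acc :
  List.Forall good_choice t -> List.Forall good_entry acc ->
  multiplicity d t acc = count (fun x => all_units acc x && agrees t x) rs.
Proof.
elim: t acc => [|[X v] t IHt] acc good_t good_acc.
  rewrite /multiplicity /= count_all_units_correct //.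
  by apply: eq_count => x; rewrite andbT.
case/List.Forall_cons_iff: good_t => -[[gM finC countC] v_gt0 f0] /IHt {}IHt.
have -> : multiplicity d ((X, v) :: t) acc = if is_zero v.2.2 then
    (multiplicity d t acc - sumn (map (fun w =>
         multiplicity d t (normalized d X.2.1 w :: acc)) X.2.2))%N
    else multiplicity d t (normalized d X.2.1 v :: acc) by [].
have count_fin w : finite_value w ->
    multiplicity d t (normalized d X.2.1 w :: acc) =
    count (fun x => [&& all_units acc x, agrees t x & has_value w (eval_at X.2.1 x)]) rs.
  move=> fw; rewrite IHt; last by constructor=> //; apply: good_normalized.
  apply: eq_in_count => x rs_x /=; rewrite normalized_at //.
  by rewrite -andbA [RHS]andbA andbC.
rewrite is_zeroE; case: ifP => [g0|g0].
  rewrite IHt //.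
  have -> : [seq multiplicity d t (normalized d X.2.1 w :: acc) | w <- X.2.2] =
    [seq count (fun x => [&& all_units acc x, agrees t x &
                             has_value w (eval_at X.2.1 x)]) rs | w <- X.2.2].
    by apply/eq_in_map => w /finC; apply: count_fin.
  (* Summing root by root instead of candidate by candidate, a root that meets the other conditions
     contributes 1 or 0 according to [countC]. *)
  rewrite sumn_count_exchange.
  rewrite (_ : sumn _ = count (fun x => [&& all_units acc x, agrees t x &
                             eval_at X.2.1 x != 0]) rs); last first.
    rewrite -sumn_count; congr sumn; apply/eq_in_map => x rs_x.
    case: (all_units acc x) => /=; last by rewrite count_pred0.
    case: (agrees t x) => /=; last by rewrite count_pred0.
    exact: countC.
  rewrite (_ : count (fun x => all_units acc x && agrees t x) rs =
     (count (fun x => [&& all_units acc x, agrees t x & (eval_at X.2.1 x != 0)%R]) rs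
     + count (fun x => [&& all_units acc x, agrees t x & (eval_at X.2.1 x == 0)%R]) rs)%N).
    rewrite addKn; apply: eq_count => x /=; rewrite /has_value g0.
    by rewrite [(_ == 0) && _]andbC.
  elim: (rs) => //= x r ->; rewrite addnACA; congr (_ + _)%N.
  by case: (all_units _ _); case: (agrees _ _); case: (_ == 0).
rewrite count_fin; last by split; rewrite ?g0.
apply: eq_count => x /=.
by rewrite [agrees t x && _]andbC.
Qed.


Lemma tuples_cons (X : coordinate) s : tuples (X :: s) =
  flatten [seq [seq (X, v) :: t | t <- tuples s] | v <- (1%N, (1, 0)) :: X.2.2].
Proof. by []. Qed.

Lemma tuples_good s : List.Forall good_coordinate s ->
  List.Forall (fun t => List.Forall good_choice t /\ map fst t = s) (tuples s).
Proof.
elim: s => [|X s IHs] good_s; first by constructor.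
case/List.Forall_cons_iff: good_s => good_X /IHs; rewrite tuples_cons.
move: (tuples s) => r good_r.
have good_v v : good_choice (X, v) -> List.Forall
    (fun t => List.Forall good_choice t /\ map fst t = X :: s)
    [seq (X, v) :: t | t <- r].
  move=> good_Xv; elim: r good_r => [|t r IHr] //=.
  case/List.Forall_cons_iff => -[good_t t_s] /IHr good_r; constructor=> //.
  by split; [constructor|rewrite /= t_s].
case: (good_X) => _ finC _.
have: {in (1%N, (1, 0)) :: X.2.2, forall v, good_choice (X, v)}.
  move=> v; rewrite inE => /orP[/eqP->|/finC[v_gt0 f0 _]]; split=> //.
  by rewrite /= rmorph1 oner_neq0.
elim: (_ :: _) => //= v V IHV good_V; apply: Forall_cat.
  by apply: good_v; apply: good_V; rewrite mem_head.
by apply: IHV => w Vw; apply: good_V; rewrite inE Vw orbT.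
Qed.

(** In each coordinate exactly one candidate fits x: oo when the value is zero, otherwise the single
    finite one. *)
Lemma count_tuples s x : List.Forall good_coordinate s -> x \in rs ->
  count (agrees^~ x) (tuples s) = 1%N.
Proof.
move=> good_s rs_x; elim: s good_s => [|X s IHs] good_s //.
case/List.Forall_cons_iff: good_s => -[gM finC countC] /IHs {}IHs.
rewrite tuples_cons count_flatten -map_comp.
rewrite (_ : sumn _ = count (has_value^~ (eval_at X.2.1 x)) ((1%N, (1, 0)) :: X.2.2)).
  by rewrite /= {1}/has_value /= rmorph0 eqxx countC //; case: eqP.
rewrite -sumn_count; congr sumn; apply: eq_map => v /=.
rewrite count_map; case: (boolP (has_value v _)) => vx.
  by rewrite -[RHS]IHs; apply: eq_count => t /=; rewrite vx.
by rewrite (@eq_count _ _ pred0) ?count_pred0 // => t /=; rewrite (negPf vx).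
Qed.

(** The roots are regrouped by the tuple they agree with. By [count_tuples] each root falls into one
    group, so this is a permutation, and the size of a group is the multiplicity of its tuple. *)
Lemma tabulate_correct (Q : seq value -> L -> Prop) s :
  List.Forall good_coordinate s ->
  (forall t x, List.Forall good_choice t -> map fst t = s -> x \in rs ->
    agrees t x -> Q (map (@rescale k) t) x) ->
  exists2 xs, perm_eq xs rs & List.Forall2 Q (tabulate d s) xs.
Proof.
move=> good_s Qt.
exists (flatten [seq [seq x <- rs | agrees t x] | t <- tuples s]).
  apply/permP => p; rewrite count_flatten -map_comp.
  rewrite (@eq_map _ _ _ (fun t => count (fun x => p x && agrees t x) rs)); last first.
    by move=> t /=; rewrite count_filter.
  rewrite sumn_count_exchange -sumn_count; congr sumn; apply/eq_in_map => x rs_x.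
  case: (p x) => /=; first exact: count_tuples.
  by rewrite count_pred0.
rewrite /tabulate; have := tuples_good good_s.
elim: (tuples s) => [|t T IHT] /=; first by constructor.
case/List.Forall_cons_iff => -[good_t t_s] /IHT {}IHT.
apply: Forall2_cat => //; rewrite multiplicity_correct //=.
apply: Forall2_nseq_filter => x rs_x agr_x; exact: Qt.
Qed.

(** * Clearing denominators *)

Variables (D : R) (Df : matrixf).
Hypothesis D_neq0 : phi D != 0.
Hypothesis DfE : \matrix_(i < d, j < d) phi (Df i j) = phi D *: C.

Lemma hornerf_correct (s : seq R) :
  phi (hornerf d D Df s).1 = phi D ^+ size s /\
  represents (hornerf d D Df s).2 (phi D ^+ size s *: Poly (map phi s)).
Proof.
elim: s => [|q s [IH1 IH2]].
  split; rewrite /= ?rmorph1 // scale1r /represents hmx0.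
  by apply/matrixP => i j; rewrite !mxE rmorph0.
split; first by rewrite /= rmorphM IH1 exprS.
rewrite /represents /= cons_poly_def.
have -> : phi D ^+ (size s).+1 *: (Poly [seq phi i | i <- s] * 'X + (phi q)%:P) =
    (phi q * phi D ^+ (size s).+1) *: 1 +
    phi D *: 'X * (phi D ^+ size s *: Poly [seq phi i | i <- s]).
  rewrite scalerDr addrC; congr (_ + _).
    by rewrite alg_polyC -mul_polyC -polyCM mulrC.
  by rewrite -scalerAl -scalerAr scalerA -exprS mulrC.
rewrite hmxD hmxM !hmxZ hmx1 hmxX -hmxZ -IH2 -DfE.
apply/matrixP => i j; rewrite !mxE rmorphD !rmorphM IH1 -exprS /onem -val_eqE.
rewrite /mulm sumfE rmorph_sum; congr (_ + _).
  by case: eqP; rewrite ?rmorph1 ?rmorph0.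
by apply: eq_bigr => l _; rewrite !mxE rmorphM.
Qed.

Lemma rescale_correct (X : coordinate) v y : phi X.1 != 0 ->
  good_choice (X, v) -> has_value v (phi X.1 * y) ->
  [/\ (0 < (rescale (X, v)).1)%N, phi (rescale (X, v)).2.1 != 0
    & exists2 u, is_unit_of W u & phi (rescale (X, v)).2.1 * y ^+ (rescale (X, v)).1
                                  = u * phi (rescale (X, v)).2.2].
Proof.
case: X v => kappa [M V] [m [f g]] /= k0 [_ /= m_gt0 f0].
rewrite /has_value /= rmorphM rmorphXn => vy; split=> //.
  by rewrite mulf_neq0 ?expf_neq0.
rewrite -mulrA -exprMn; move: vy; case: eqP => [->|/eqP g0 Uy].
  rewrite mulf_eq0 (negPf k0) => /eqP->.
  exists 1; first exact/vunitP/vunit1.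
  by rewrite mulr0 expr0n gtn_eqF // !mulr0.
by exists (phi f * (phi kappa * y) ^+ m / phi g); [apply/vunitP|rewrite divfK].
Qed.


Definition fractions (q : seq (R * R)) : {poly L} :=
  Poly [seq phi ab.1 / phi ab.2 | ab <- q].

Definition proper (q : seq (R * R)) : bool := all (fun ab => phi ab.2 != 0) q.

Lemma clear_correct (q : seq (R * R)) : proper q ->
  phi (clear q).1 != 0 /\
  Poly (map phi (clear q).2) = phi (clear q).1 *: fractions q.
Proof.
elim: q => [|[a b] q IHq] /=; first by rewrite rmorph1 scaler0 oner_neq0.
case/andP=> b0 /IHq[D0 IH]; split; first by rewrite rmorphM mulf_neq0.
have PolyZ e s : Poly (map phi (map (fun x : R => e * x) s)) = phi e *: Poly (map phi s).
  elim: s => [|x s IHs] /=; first by rewrite scaler0.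
  rewrite !cons_poly_def IHs rmorphM scalerDr scalerAl.
  by rewrite -[_ *: (phi x)%:P]mul_polyC -polyCM.
rewrite /fractions /= !cons_poly_def PolyZ IH !(rmorphM phi) scalerDr scalerAl scalerA.
rewrite -[_ *: (_ / _)%:P]mul_polyC -polyCM.
by congr (_ + _%:P); field.
Qed.

Lemma sizepE (s : seq R) : sizep s = size (Poly (map phi s)).
Proof.
elim: s => [|x s IHs] /=; first by rewrite size_poly0.
by rewrite size_cons_poly IHs is_zeroE nil_poly -size_poly_eq0.
Qed.

Lemma companionf_correct (s : seq R) : Poly (map phi s) = phi D *: P ->
  \matrix_(i < d, j < d) phi (companionf d D s i j) = phi D *: C.
Proof.
move=> sP; apply/matrixP => i j; rewrite !mxE /companionf.
have -> : P`_j = (phi D)^-1 * phi (s`_j).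
  apply: (mulfI D_neq0); rewrite mulVKf // -coefZ -sP coef_Poly.
  have [lt_js|le_sj] := ltnP j (size s); first exact: nth_map.
  by rewrite !nth_default ?size_map ?rmorph0.
case: (i.+1 == d); first by rewrite rmorphN mulrN mulVKf.
by case: (i.+1 == j); rewrite ?mulr1 ?mulr0 ?rmorph0.
Qed.

Lemma make_coordinate_correct (q : seq (R * R)) : proper q ->
  [/\ good_coordinate (make_coordinate d D Df (clear q)),
      phi (make_coordinate d D Df (clear q)).1 != 0
    & {in rs, forall x, eval_at (make_coordinate d D Df (clear q)).2.1 x =
        phi (make_coordinate d D Df (clear q)).1 * (fractions q).[x]}].
Proof.
case/clear_correct; case: (clear q) => E s /= E0 defs.
have [sc hq] := hornerf_correct s; split.
- by apply: good_coordinate_slopes; exists (phi D ^+ size s *: Poly (map phi s)).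
- by rewrite rmorphM sc mulf_neq0 ?expf_neq0.
- by move=> x rs_x; rewrite (eval_atE hq) // defs !hornerZ mulrA rmorphM sc.
Qed.

(** The analogue of [is_value] with [phi] in place of evaluation followed by the embeddings. *)
Definition describes (v : value) (y : L) : Prop :=
  [/\ (0 < v.1)%N, phi v.2.1 != 0
    & exists2 u, is_unit_of W u & phi v.2.1 * y ^+ v.1 = u * phi v.2.2].

Lemma solve_cleared_correct (qs : seq (seq (R * R))) : all proper qs ->
  exists2 xs, perm_eq xs rs &
    List.Forall2 (fun vs x => List.Forall2 describes vs
        (x :: [seq (fractions q).[x] | q <- qs]))
      (solve_cleared d D Df qs) xs.
Proof.
move=> proper_qs; rewrite /solve_cleared.
set qs' := [:: _; _] :: qs.
have proper_qs' : all proper qs' by rewrite /= rmorph1 oner_neq0.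
have -> : (fun vs x => List.Forall2 describes vs
      (x :: [seq (fractions q).[x] | q <- qs])) =
    (fun vs x => List.Forall2 describes vs [seq (fractions q).[x] | q <- qs']).
  extensionality vs; extensionality x; congr List.Forall2; rewrite /qs' /=; congr (_ :: _).
  rewrite /fractions /= rmorph0 rmorph1 !divr1 !cons_poly_def mul0r add0r addr0.
  by rewrite mul1r hornerX.
apply: tabulate_correct.
  elim: qs' proper_qs' => [|q qs1 IHqs] /=; first by constructor.
  by case/andP=> /make_coordinate_correct[good_X _ _] /IHqs; constructor.
move=> t x good_t def_t rs_x; elim: qs' proper_qs' t good_t def_t => [|q qs1 IHqs] /=.
  by move=> _ [] // _ _ _; constructor.
case/andP=> /make_coordinate_correct[_ X0 XE] /IHqs{}IHqs [|[X v] t] //.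
case/List.Forall_cons_iff => good_Xv good_t [def_X def_t] /= /andP[Xv_x t_x].
constructor; last exact: IHqs.
apply: rescale_correct => //; first by rewrite def_X.
by rewrite /= def_X -XE // -def_X.
Qed.


End Correctness.

(** * From integer polynomials to the valued field *)

Lemma solve_correct (k : ctx) (L : closedFieldType) (W : {pred L})
    (phi : {rmorphism {mpoly int[cn k]} -> L}) p qs :
  valuation_ring W ->
  (forall f : {mpoly int[cn k]}, is_zero f = (phi f == 0)) ->
  (forall f g : {mpoly int[cn k]}, divides f g = vdvd W (phi f) (phi g)) ->
  proper phi p -> fractions phi p \is monic -> all (proper phi) qs ->
  exists2 xs, fractions phi p = \prod_(x <- xs) ('X - x%:P) &
    List.Forall2 (fun vs x => List.Forall2 (describes W phi) vs
        (x :: [seq (fractions phi q).[x] | q <- qs]))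
      (solve (p, qs)) xs.
Proof.
move=> valW is_zeroE dividesE proper_p mon_p proper_qs.
have [D0 defD] := clear_correct proper_p.
have [rs] := closed_field_poly_normal (fractions phi p).
rewrite (monicP mon_p) scale1r => p_split.
have size_p : size (fractions phi p) = (sizep (clear p).2).-1.+1.
  rewrite (sizepE is_zeroE) defD size_scale //.
  by rewrite prednK // size_poly_gt0 monic_neq0.
have [xs perm_xs out_xs] := solve_cleared_correct valW is_zeroE dividesE mon_p
  size_p p_split D0 (companionf_correct _ D0 defD) proper_qs.
by exists xs; rewrite // p_split (perm_big _ perm_xs).
Qed.

Theorem mainTheorem2 :
  exists A : algorithm input_ty output_ty,
  forall (K : fieldType) (V : {pred K})
         (S : comNzRingType) (iS : {rmorphism S -> K}) (dvdV : rel S)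
         (L : closedFieldType) (iL : {rmorphism K -> L}) (W : {pred L}),
    (* V is a valuation ring of K *)
    valuation_ring V ->
    (* S is a subring of V with quotient field K *)
    injective iS ->
    (forall s : S, iS s \in V) ->
    (forall x : K, exists a b : S, b != 0 /\ x = iS a / iS b) ->
    (* the divisibility test *)
    (forall a b : S, reflect (divides_in V (iS a) (iS b)) (dvdV a b)) ->
    (* L is an algebraic closure of K, and W extends V *)
    (forall y : L, algebraicOver iL y) ->
    valuation_ring W ->
    (forall x : K, (iL x \in W) = (x \in V)) ->
  forall (P : {poly K}) (Qs : seq {poly K}),
    P \is monic ->
  forall (n : nat) (c : 'I_n -> S)
         (p : seq ('I_n * 'I_n)) (qs : seq (seq ('I_n * 'I_n))),
    presents iS c p P ->
    List.Forall2 (presents iS c) qs Qs ->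
  exists out : seq (seq (nat * ({mpoly int[n]} * {mpoly int[n]}))),
    computes dvdV c A (input p qs) out /\
    exists2 xs : seq L,
      map_poly iL P = \prod_(x <- xs) ('X - x%:P) &
      List.Forall2
        (fun (vs : seq (nat * ({mpoly int[n]} * {mpoly int[n]}))) (x : L) =>
           List.Forall2 (is_value (fun s : S => iL (iS s)) W c)
             vs (x :: [seq (map_poly iL Q).[x] | Q <- Qs]))
        out xs.
Proof.
have [A computes_A] := definable_computable def_solve.
exists A => K V S iS dvdV L iL W valV iS_inj SV fracS dvdVP _ valW WV P Qs monP.
move=> n c p qs p_P qs_Qs; pose k := @Ctx S dvdV n c.
exists (solve (input p qs : interp (cn k) input_ty)); split; first exact: (computes_A k).
have [phi phiE] : exists phi : {rmorphism {mpoly int[cn k]} -> L},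
    forall f, phi f = iL (iS (zeval c f)).
  by exists (iL \o (iS \o mmap intr c)).
have phi_eq0 f : (phi f == 0) = (zeval c f == 0).
  by rewrite phiE fmorph_eq0 -(inj_eq iS_inj) rmorph0.
have is_zeroE (f : {mpoly int[cn k]}) : is_zero f = (phi f == 0).
  by rewrite phi_eq0.
have dividesE (f g : {mpoly int[cn k]}) : divides f g = vdvd W (phi f) (phi g).
  (* The quotient of two elements coming from S lies in K, where W restricts to V, so divisibility
     in V and in W agree. *)
  apply/dvdVP/vdvdP => // -[w Ww].
    by move=> fg; exists (iL w); rewrite ?WV // !phiE -rmorphM -fg.
  rewrite !phiE; have [->|f0] := eqVneq (iS (zeval c f)) 0.
    move/eqP; rewrite rmorph0 mulr0 fmorph_eq0 => /eqP->.
    by exists 0; rewrite ?mulr0 // (val0 valV).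
  move=> fg; exists (iS (zeval c g) / iS (zeval c f)); last by rewrite divfK.
  by rewrite -WV fmorph_div fg mulfK // fmorph_eq0.
have phiX i : phi 'X_i = iL (iS (c i)) by rewrite phiE /zeval mmapX mmap1U.
have fractionsE q (Q : {poly K}) : presents iS c q Q ->
    proper (k := k) phi (poly_in q) /\
      map_poly iL Q = fractions (k := k) phi (poly_in q).
  case=> q0 ->; split.
    rewrite /proper all_map; apply: sub_all q0 => ij /= c0.
    by rewrite phiX fmorph_eq0 -(rmorph0 iS) (inj_eq iS_inj).
  rewrite /fractions; elim: q {q0} => [|ij q IHq] /=; first by rewrite rmorph0.
  rewrite !cons_poly_def rmorphD rmorphM /= map_polyX map_polyC /= IHq.
  by rewrite fmorph_div -!phiX.
have [proper_p P_p] := fractionsE _ _ p_P.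
have mon_p : fractions (k := k) phi (poly_in p) \is monic.
  by rewrite -P_p map_monic.
have proper_qs : all (proper (k := k) phi) [seq poly_in q | q <- qs].
  by elim: qs_Qs => //= q Q {}qs {}Qs /fractionsE[-> _] _ ->.
have [xs p_xs out_xs] :=
  solve_correct valW is_zeroE dividesE proper_p mon_p proper_qs.
exists xs; first by rewrite P_p.
have evalE x : [seq (fractions (k := k) phi q).[x] | q <- [seq poly_in q | q <- qs]] =
    [seq (map_poly iL Q).[x] | Q <- Qs].
  by elim: qs_Qs => //= q Q qs' Qs' /fractionsE[_ ->] _ ->.
apply: List.Forall2_impl out_xs => vs x; rewrite evalE.
apply: List.Forall2_impl => -[m [f g]] y [m_gt0 f0 u_fg].
split=> //; first by rewrite -phi_eq0.
by case: u_fg => u Uu; rewrite !phiE; exists u.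
Qed.
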